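(* Let $\varepsilon\in\{1,-1\}$, let $B$ be a finite ring with $2\in B^\times$, having an involution $*$ and a primitive linear character $\beta:B^+\to\mathbb{C}^\times$ satisfying $\beta(b+\varepsilon b^* )=1$ for all $b\in B$, and extend $*$ to $A=M(m,B)$ by $(x^* )_{ij}=(x_{ji})^*$. Suppose moreover that $m=2n$ is even if $\varepsilon=1$. Let $P$ be the column space $B^m$ and let $X$ be a complex vector space with basis $(e_v)_{v\in P}$. Set - $\chi(a,b)=\beta(2a^*b)$ for $a,b\in P$; - $\gamma(S,a)=\beta(-\varepsilon a^*Sa)$ for $a\in P$ and $S\in A$ with $S^*+\varepsilon S=0$; - $\alpha=\mu$; - $f=\widehat{G}(\beta)^{-m}(-1)^{\frac{|B|^m-1}{2}}$ if $\varepsilon=-1$, and $f=1/|B|^n$ if $\varepsilon=1$. Then: (1) $(P,\chi,\gamma,\alpha,f)$ is a data for $(A,\varepsilon)$. (2) There exists one and only one representation $W:\mathrm{SSL}^{\varepsilon}_*(2,A)\to\mathrm{GL}(X)$ such that, for all $x\in P$, $t\in A^\times$ and $r\in A$ with $r+\varepsilon r^*=0$, $$W(h_t)e_x=\alpha(t)e_{(t^* )^{-1}x},\qquad W(u_r)e_x=\gamma(r,x)e_x,\qquad W(\omega)e_x=f\sum_{y\in P}\chi(x,y)e_y,$$ and it coincides with the restriction to $\mathrm{SSL}^{\varepsilon}_*(2,A)$ of the Weil representation of type $\beta$ of $\mathrm{SL}^{\varepsilon}_*(2,A)$ constructed via Heisenberg groups. (3) If $B$ is local, then $\mathrm{SSL}^{\varepsilon}_*(2,A)$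 can be replaced by $\mathrm{SL}^{\varepsilon}_*(2,A)$ in (2), except only when $\varepsilon=1$ and $*$ is ramified, in which case $[\mathrm{SL}^{+}_*(2,A):\mathrm{SSL}^{+}_*(2,A)]=2$.
   Context: Rings have identity $1\ne 0$; an involution is an antiautomorphism of order 1 or 2. A linear character $\beta:B^+\to\mathbb{C}^\times$ (group homomorphism on the additive group) is primitive if its kernel contains no right ideal of $B$ other than $(0)$. **Groups.** $\mathrm{SL}^{\varepsilon}_*(2,A)$ is the group of all $\begin{pmatrix} a&b\\c&d\end{pmatrix}\in\mathrm{GL}(2,A)$ with $a^*c=-\varepsilon c^*a$, $b^*d=-\varepsilon d^*b$, $d^*a+\varepsilon b^*c=1$; equivalently all $g\in\mathrm{GL}(2m,B)$ with $g^*Jg=J$, $J=\begin{pmatrix}0&1_m\\ \varepsilon 1_m&0\end{pmatrix}$. Write $A^{\varepsilon\text{-sym}}=\{s\in A: s+\varepsilon s^*=0\}$. Bruhat elements: $\omega=\begin{pmatrix}0&1\\ \varepsilon&0\end{pmatrix}$, $h_t=\begin{pmatrix}t&0\\0&(t^* )^{-1}\end{pmatrix}$ ($t\in A^\times$), $u_r=\begin{pmatrix}1&r\\0&1\end{pmatrix}$ ($r\in A^{\varepsilon\text{-sym}}$). $\mathrm{SSL}^{\varepsilon}_*(2,A)$ is the subgroup they generate. **The function $\mu$ and the sum $\widehat G(\beta)$.** Let $I\subset B^m\setminus\{0\}$ contain exactly one element of each set $\{v,-v\}$, $0\ne v\in B^m$. For $Y\in\mathrm{GL}(m,B)$ let $I_Y=\{v\in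 I: Yv\in -I\}$ and $\mu(Y)=(-1)^{|I_Y|}$. Then $\mu:\mathrm{GL}(m,B)\to\{1,-1\}$ is a group homomorphism independent of $I$. Also $\widehat{G}(\beta)=\sum_{b\in B}\beta(b^*b)$ (nonzero when $\varepsilon=-1$). **Data.** A data for $(A,\varepsilon)$ is a 5-tuple $(P,\chi,\gamma,\alpha,f)$ where $P$ is a finite left $A$-module, $\chi:P\times P\to\mathbb{C}^\times$ is additive in each variable (i.e. a homomorphism in each variable), $\gamma:A^{\varepsilon\text{-sym}}\times P\to\mathbb{C}^\times$ is a function, $\alpha:A^\times\to\mathbb{C}^\times$ is a group homomorphism, $f\in\mathbb{C}^\times$, and: (i) $\alpha(t^*t)\chi(tx,y)=\chi(x,t^*y)$ for $x,y\in P$, $t\in A^\times$; (ii) $\chi(y,x)=\chi(x,y)^{-\varepsilon}$ for $x,y\in P$; (iii) if $\chi(x,y)=1$ for all $x\in P$ then $y=0$; (iv) $\gamma(b+b',x)=\gamma(b,x)\gamma(b',x)$ for $x\in P$, $b,b'\in A^{\varepsilon\text{-sym}}$; (v) $\gamma(b,tx)=\gamma(t^*bt,x)$ for $x\in P$, $b\in A^{\varepsilon\text{-sym}}$, $t\in A^\times$; (vi) $\gamma(t,x+z)=\gamma(t,x)\gamma(t,z)\chi(tz,x)$ for $x,z\in P$, $t\in A^{\varepsilon\text{-sym}}\cap A^\times$; (vii) $f^2|P|=\alpha(\varepsilon)$; (viii) $f\,\gamma(-\varepsilon t,x)\sum_{y\in P}\chi(x,y)\gamma(t^{-1},y)=\alpha(-t)$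 for $x\in P$, $t\in A^{\varepsilon\text{-sym}}\cap A^\times$. **Weil representation via Heisenberg groups.** Let $V$ be a free right $B$-module with basis $u_1,\dots,u_m,v_1,\dots,v_m$ and $h:V\times V\to B$ the $\varepsilon$-hermitian form (i.e. $B$-linear in the second variable, with $h(u,v)^*=\varepsilon h(v,u)$) with Gram matrix $J$ in this basis; $\mathrm{SL}^{\varepsilon}_*(2,A)$ is identified with the unitary group of $h$ via matrices in this basis. Let $M$, $N$ be the spans of the $u_i$ and the $v_i$ respectively, and identify $N$ with $B^m$ via $\sum v_ia_i\leftrightarrow a$. The Heisenberg group $H$ is the set $B\times V$ with $(b,u)(c,v)=(b+c+h(u,v),u+v)$, on which $g\in\mathrm{SL}^{\varepsilon}_*(2,A)$ acts by ${}^g(b,u)=(b,gu)$. The Schrödinger representation $S:H\to\mathrm{GL}(X)$ of type $\beta$ is determined by $S(b,0)e_v=\beta(b)e_v$, $S(0,w)e_v=e_{v+w}$, $S(0,u)e_v=\beta(2h(u,v))e_v$ for $b\in B$, $v,w\in N$, $u\in M$. For each $g$ there is an operator $P(g)\in\mathrm{GL}(X)$, unique up to scaling, with $P(g)S(k)P(g)^{-1}=S({}^gk)$ for all $k\in H$. Let $X_\pm$ be the $\pm1$-eigenspaces of the operator $e_v\mapsto e_{-v}$; they are preserved by all $P(g)$. Put $c(g)=(\det P(g)|_{X_+})^{-1}\det P(g)|_{X_-}$. Then $W(g)=c(g)P(g)$ is independent of the scaling of $P(g)$ and is a representation of $\mathrm{SL}^{\varepsilon}_*(2,A)$ on $X$,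 called the Weil representation of type $\beta$. **Local case.** If $B$ is local with Jacobson radical $\mathfrak r$, $*$ is ramified if it induces the identity map on $B/\mathfrak{r}$. *)

(* Defs.v *)
From HB Require Import structures.
From mathcomp Require Import all_boot all_order all_algebra all_fingroup.
From mathcomp Require Import classical_sets reals complex.

Set Implicit Arguments.
Unset Strict Implicit.
Unset Printing Implicit Defensive.

Import Order.TTheory GRing.Theory Num.Theory.
Local Open Scope ring_scope.

(* M(n+1, B) for a finite, possibly noncommutative, ring B.  An alias of       *)
(* 'M[B]_n.+1 is needed because MathComp equips matrix rings with units only   *)
(* over commutative rings; here the units are the two-sided invertible ones.   *)
Definition matring (B : finNzRingType) (n : nat) : Type := 'M[B]_n.+1.

Section MatrixRing.
Variables (B : finNzRingType) (n : nat).
Local Notation A := (matring B n).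

HB.instance Definition _ := GRing.NzRing.copy A 'M[B]_n.+1.
HB.instance Definition _ := Finite.copy A 'M[B]_n.+1.

Definition matring_unit : pred A :=
  fun a => [exists b : A, (b * a == 1) && (a * b == 1)].
Definition matring_inv (a : A) : A :=
  odflt a [pick b : A | (b * a == 1) && (a * b == 1)].

Fact matring_mulVr : {in matring_unit, left_inverse 1 matring_inv *%R}.
Proof.
move=> a /existsP[b hb]; rewrite /matring_inv.
by case: pickP => [c /andP[/eqP] // | /(_ b)]; rewrite hb.
Qed.

Fact matring_mulrV : {in matring_unit, right_inverse 1 matring_inv *%R}.
Proof.
move=> a /existsP[b hb]; rewrite /matring_inv.
by case: pickP => [c /andP[_ /eqP] // | /(_ b)]; rewrite hb.
Qed.

Fact matring_unitP (a b : A) : b * a = 1 /\ a * b = 1 -> matring_unit a.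
Proof. by case=> ba ab; apply/existsP; exists b; rewrite ba ab !eqxx. Qed.

Fact matring_inv_out : {in [predC matring_unit], matring_inv =1 id}.
Proof.
move=> a /= na; rewrite /matring_inv; case: pickP => // b hb.
by case/negP: na; apply/existsP; exists b.
Qed.

HB.instance Definition _ := GRing.NzRing_hasMulInverse.Build A
  matring_mulVr matring_mulrV matring_unitP matring_inv_out.

End MatrixRing.

(* The column space B^(n+1) as a left M(n+1, B)-module.  The alias keeps this  *)
(* scalar action apart from the left B-module structure of 'cV[B]_n.+1.        *)
Definition colspace (B : finNzRingType) (n : nat) : Type := 'cV[B]_n.+1.

Section ColumnSpace.
Variables (B : finNzRingType) (n : nat).

HB.instance Definition _ := GRing.Zmodule.copy (colspace B n) 'cV[B]_n.+1.
HB.instance Definition _ := Finite.copy (colspace B n) 'cV[B]_n.+1.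

Definition col_scale (a : matring B n) (x : colspace B n) : colspace B n :=
  (a : 'M_n.+1) *m (x : 'cV_n.+1).

Fact col_scaleA a b x : col_scale a (col_scale b x) = col_scale (a * b) x.
Proof. exact: mulmxA. Qed.
Fact col_scale1 : left_id 1 col_scale.
Proof. exact: mul1mx. Qed.
Fact col_scaleDr : right_distributive col_scale +%R.
Proof. by move=> a x y; apply: mulmxDr. Qed.
Fact col_scaleDl x : {morph col_scale^~ x : a b / a + b}.
Proof. by move=> a b; apply: mulmxDl. Qed.

HB.instance Definition _ := GRing.Zmodule_isLmodule.Build
  (matring B n) (colspace B n) col_scaleA col_scale1 col_scaleDr col_scaleDl.

End ColumnSpace.

Section RingNotions.
Variable B : finUnitRingType.

Definition is_involution (star : B -> B) : Prop :=
  [/\ {morph star : a b / a + b}, star 1 = 1,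
      forall a b, star (a * b) = star b * star a & involutive star].

Definition right_ideal (K : {set B}) : bool :=
  [&& 0 \in K, [forall x in K, forall y in K, x - y \in K]
    & [forall x in K, forall b, x * b \in K]].

Definition maximal_right_ideal (K : {set B}) : bool :=
  [&& right_ideal K, K != [set: B]
    & [forall L : {set B}, right_ideal L && (K \subset L)
                           ==> (L == K) || (L == [set: B])]].

Definition local_ring : Prop := exists! K : {set B}, maximal_right_ideal K.

Definition jacobson_radical : {set B} :=
  \bigcap_(K | maximal_right_ideal K) K.

Definition ramified (star : B -> B) : Prop :=
  forall b, star b - b \in jacobson_radical.

Variable C : fieldType.

Definition linear_character (beta : B -> C) : Prop :=
  (forall b, beta b != 0) /\ {morph beta : a b / a + b >-> a * b}.

Definition primitive_character (beta : B -> C) : Prop :=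
  forall K : {set B}, right_ideal K -> {in K, forall b, beta b = 1} ->
  K = [set 0].

End RingNotions.

Section StarGroups.
Variables (A : finUnitRingType) (star : A -> A) (eps : int).

Definition eps_sym (s : A) : bool := s + eps%:~R * star s == 0.

Definition mx22 (a b c d : A) : matring A 1 :=
  \matrix_(i, j) if i == 0 then (if j == 0 then a else b)
                 else (if j == 0 then c else d).

Definition ent (g : {unit matring A 1}) (i j : 'I_2) : A := (val g : 'M_2) i j.

Definition SLstar : {set {unit matring A 1}} :=
  [set g : {unit matring A 1} |
    let a := ent g 0 0 in let b := ent g 0 1 in
    let c := ent g 1 0 in let d := ent g 1 1 in
    [&& star a * c == - (eps%:~R * star c * a),
        star b * d == - (eps%:~R * star d * b)
      & star d * a + eps%:~R * star b * c == 1]].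

(* The default value 1 of insubd is never met: see bruhat_omegaE,              *)
(* bruhat_hE and bruhat_uE below.                                              *)
Definition bruhat_omega : {unit matring A 1} :=
  insubd (1%g : {unit matring A 1}) (mx22 0 1 eps%:~R 0).
Definition bruhat_h (t : A) : {unit matring A 1} :=
  insubd (1%g : {unit matring A 1}) (mx22 t 0 0 (star t)^-1).
Definition bruhat_u (r : A) : {unit matring A 1} :=
  insubd (1%g : {unit matring A 1}) (mx22 1 r 0 1).

Definition SSLstar : {set {unit matring A 1}} :=
  <<bruhat_omega |: ([set bruhat_h t | t : A & t \is a GRing.unit]
                     :|: [set bruhat_u r | r : A & eps_sym r])>>%g.

Lemma mul_mx22 a b c d a' b' c' d' :
  mx22 a b c d * mx22 a' b' c' d' =
  mx22 (a * a' + b * c') (a * b' + b * d') (c * a' + d * c') (c * b' + d * d').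
Proof.
by apply/matrixP=> i j; rewrite !mxE big_ord_recl big_ord1 !mxE /=;
  case: i j => [[|[|?]] ?] [[|[|?]] ?].
Qed.

Lemma mx22_1 : mx22 1 0 0 1 = 1.
Proof.
by apply/matrixP=> i j; rewrite !mxE /=; case: i j => [[|[|?]] ?] [[|[|?]] ?].
Qed.

Lemma mx22_unit (M N : matring A 1) :
  N * M = 1 -> M * N = 1 -> M \is a GRing.unit.
Proof. by move=> NM MN; apply/unitrP; exists N. Qed.

Lemma bruhat_omegaE : eps = 1 \/ eps = -1 ->
  val bruhat_omega = mx22 0 1 eps%:~R 0.
Proof.
move=> heps; rewrite insubdK //.
apply: (@mx22_unit _ (mx22 0 eps%:~R 1 0)); rewrite mul_mx22 -mx22_1;
  congr mx22; rewrite ?mul0r ?mulr0 ?mul1r ?mulr1 ?addr0 ?add0r //;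
  by case: heps => ->; rewrite ?mulrNz ?mulrNN mulr1z mulr1.
Qed.

Lemma bruhat_hE t : is_involution star -> t \is a GRing.unit ->
  val (bruhat_h t) = mx22 t 0 0 (star t)^-1.
Proof.
move=> [_ s1 sM _] ut; rewrite insubdK //.
have ust : star t \is a GRing.unit.
  by apply/unitrP; exists (star t^-1); rewrite -!sM mulVr // mulrV // s1.
apply: (@mx22_unit _ (mx22 t^-1 0 0 (star t))); rewrite mul_mx22 -mx22_1;
  by congr mx22; rewrite ?mul0r ?mulr0 ?addr0 ?add0r ?(mulVr ut) ?(mulrV ut)
    ?(mulVr ust) ?(mulrV ust).
Qed.

Lemma bruhat_uE r : val (bruhat_u r) = mx22 1 r 0 1.
Proof.
rewrite insubdK //.
apply: (@mx22_unit _ (mx22 1 (- r) 0 1)); rewrite mul_mx22 -mx22_1;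
  by congr mx22; rewrite ?mul0r ?mulr0 ?mul1r ?mulr1 ?addr0 ?add0r ?subrr ?addNr.
Qed.

End StarGroups.

(* alpha and the first argument of gamma live on A, but only their values on   *)
(* units, respectively on eps-symmetric elements, are constrained or used.     *)
Record is_data (C : fieldType) (A : finUnitRingType) (star : A -> A) (eps : int)
    (P : finLmodType A) (chi : P -> P -> C) (gamma : A -> P -> C)
    (alpha : A -> C) (f : C) : Prop := IsData {
  data_chi_neq0 : forall x y, chi x y != 0;
  data_chiDl : forall x x' y, chi (x + x') y = chi x y * chi x' y;
  data_chiDr : forall x y y', chi x (y + y') = chi x y * chi x y';
  data_gamma_neq0 : forall b x, eps_sym star eps b -> gamma b x != 0;
  data_alpha_neq0 : forall t, t \is a GRing.unit -> alpha t != 0;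
  data_alphaM : {in GRing.unit &, {morph alpha : s t / s * t}};
  data_f_neq0 : f != 0;
  data_i : forall t x y, t \is a GRing.unit ->
    alpha (star t * t) * chi (t *: x) y = chi x (star t *: y);
  data_ii : forall x y, chi y x = chi x y ^ (- eps);
  data_iii : forall y, (forall x, chi x y = 1) -> y = 0;
  data_iv : forall b b' x, eps_sym star eps b -> eps_sym star eps b' ->
    gamma (b + b') x = gamma b x * gamma b' x;
  data_v : forall b t x, eps_sym star eps b -> t \is a GRing.unit ->
    gamma b (t *: x) = gamma (star t * b * t) x;
  data_vi : forall t x z, eps_sym star eps t -> t \is a GRing.unit ->
    gamma t (x + z) = gamma t x * gamma t z * chi (t *: z) x;
  data_vii : f ^+ 2 * #|P|%:R = alpha eps%:~R;
  data_viii : forall t x, eps_sym star eps t -> t \is a GRing.unit ->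
    f * gamma (- (eps%:~R * t)) x * \sum_(y : P) chi x y * gamma t^-1 y
    = alpha (- t)
}.

Section Operators.
Variables (C : fieldType) (X : vectType C).

Definition representation_on (gT : finGroupType) (G : {set gT})
    (W : gT -> 'End(X)) : Prop :=
  W 1%g = \1%VF /\ {in G &, forall g k, W (g * k)%g = (W g \o W k)%VF}.

(* The determinant of the restriction of f to U, when U is stable under f.     *)
Definition det_restr (U : {vspace X}) (f : 'End(X)) : C :=
  \det (\matrix_(i < \dim U, j < \dim U) coord (vbasis U) i (f (vbasis U)`_j)).

Variables (P : finZmodType) (e : P -> X).

(* The operator e_v |-> e_(-v). *)
Definition parity : 'End(X) :=
  linfun (sval (linear_of_free (codom e) [seq e (- v) | v : P])).

Lemma parityE : free (codom e) -> forall v, parity (e v) = e (- v).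
Proof.
move=> fe v; rewrite lfunE /=; case: linear_of_free => h /= hP.
have {hP} := hP fe; rewrite !size_map => /(_ erefl).
by rewrite /codom /image_mem -map_comp => /eq_in_map; apply; rewrite mem_enum.
Qed.

Definition Xplus : {vspace X} := passmx.leigenspace parity 1.
Definition Xminus : {vspace X} := passmx.leigenspace parity (- 1).

Definition det_ratio (T : 'End(X)) : C :=
  (det_restr Xplus T)^-1 * det_restr Xminus T.

End Operators.

Section Weil.
Variables (B : finUnitRingType) (star : B -> B) (eps : int) (m : nat).

Local Notation A := (matring B m).
Local Notation P := (colspace B m).

Definition star_trmx (a : A) : A := \matrix_(i, j) star ((a : 'M_m.+1) j i).

(* dotstar a b is a^* b, an element of B. *)
Definition dotstar (a b : P) : B :=
  \sum_(i < m.+1) star ((a : 'cV_m.+1) i 0) * (b : 'cV_m.+1) i 0.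

Definition half_system (I : {set P}) : Prop :=
  0 \notin I /\
  (forall v : P, v != 0 -> #|I :&: [set v; - v]| = 1%N).

(* An element of V is given by its coordinates on u_1, ..., u_m and on         *)
(* v_1, ..., v_m; in this way M = P * 0 and N = 0 * P.                         *)
Definition hform (x y : P * P) : B :=
  dotstar x.1 y.2 + eps%:~R * dotstar x.2 y.1.

Definition act22 (g : {unit matring A 1}) (x : P * P) : P * P :=
  (ent g 0 0 *: x.1 + ent g 0 1 *: x.2, ent g 1 0 *: x.1 + ent g 1 1 *: x.2).

Definition heis_mul (k l : B * (P * P)) : B * (P * P) :=
  (k.1 + l.1 + hform k.2 l.2, k.2 + l.2).

Definition heis_act (g : {unit matring A 1}) (k : B * (P * P)) : B * (P * P) :=
  (k.1, act22 g k.2).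

Section Complex.
Variables (R : realType).
Local Notation C := R[i].

Section Sign.
Variable I : {set P}.

Definition mu (Y : A) : C :=
  (-1) ^+ #|[set v in I | Y *: v \in [set - w | w in I]]|.

End Sign.

Variable beta : B -> C.

Definition gauss_sum : C := \sum_(b : B) beta (star b * b).

Definition weil_chi (a b : P) : C := beta (2%:R * dotstar a b).

Definition weil_gamma (S : A) (a : P) : C :=
  beta (- (eps%:~R * dotstar a (S *: a))).

Definition weil_f (n : nat) : C :=
  if eps == -1
  then gauss_sum ^- m.+1 * (-1) ^+ ((#|B| ^ m.+1 - 1) %/ 2)%N
  else #|B|%:R ^- n.

Variables (X : vectType C) (e : P -> X).

Definition is_schrodinger (S : B * (P * P) -> 'End(X)) : Prop :=
  [/\ S (0, (0, 0)) = \1%VF,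
      forall k l, S (heis_mul k l) = (S k \o S l)%VF,
      forall b v, S (b, (0, 0)) (e v) = beta b *: e v,
      forall w v, S (0, (0, w)) (e v) = e (v + w)
    & forall u v,
        S (0, (u, 0)) (e v) = beta (2%:R * hform (u, 0) (0, v)) *: e v].

Definition intertwiner (g : {unit matring A 1}) (T : 'End(X)) : Prop :=
  lker T = 0%VS /\
  exists2 S, is_schrodinger S &
    forall k, (T \o S k \o T^-1)%VF = S (heis_act g k).

(* W(g) = c(g) P(g); P(g) is chosen among the (nonzero multiples of one        *)
(* another) operators intertwining S and its transform by g.                   *)
Definition heisenberg_weil (g : {unit matring A 1}) : 'End(X) :=
  let T := xget 0 [set T | intertwiner g T]%classic in det_ratio e T *: T.

Definition bruhat_formulas (alpha : A -> C) (gamma : A -> P -> C)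
    (chi : P -> P -> C) (f : C) (W : {unit matring A 1} -> 'End(X)) : Prop :=
  [/\ forall t x, t \is a GRing.unit ->
        W (bruhat_h star_trmx t) (e x) = alpha t *: e ((star_trmx t)^-1 *: x),
      forall r x, eps_sym star_trmx eps r ->
        W (bruhat_u r) (e x) = gamma r x *: e x
    & forall x,
        W (bruhat_omega A eps) (e x) = f *: \sum_(y : P) chi x y *: e y].

(* Maps on G are represented by maps on GL(2, A), considered up to their       *)
(* values outside G.                                                           *)
Definition unique_weil_on (G : {set {unit matring A 1}}) (alpha : A -> C)
    (gamma : A -> P -> C) (chi : P -> P -> C) (f : C) : Prop :=
  exists W : {unit matring A 1} -> 'End(X),
    [/\ representation_on G W,
        bruhat_formulas alpha gamma chi f W,
        (forall W' : {unit matring A 1} -> 'End(X),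
           representation_on G W' -> bruhat_formulas alpha gamma chi f W' ->
           {in G, W' =1 W})
      & {in G, W =1 heisenberg_weil}].

End Complex.
End Weil.

(* Main.v *)
From HB Require Import structures.
Require Import Defs.
From mathcomp Require Import all_boot all_order all_algebra all_fingroup.
From mathcomp Require Import all_field generic_quotient ring_quotient ring.
From mathcomp Require Import boolp classical_sets reals complex.

Set Implicit Arguments.
Unset Strict Implicit.
Unset Printing Implicit Defensive.

Import Order.TTheory GRing.Theory Num.Theory.
Local Open Scope ring_scope.

(** The proof runs through one construction. For [g] in the unitary group let [T] be
    any invertible operator intertwining the Schrodinger representation with its
    transform by [g]. By Schur's lemma ([schrodinger_irreducible]) [T] is unique up
    to a scalar, and since the even part [X+] of [X] has one dimension more than the
    odd part [X-], the operator [det_ratio T *: T] does not depend on that scalar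
    ([det_ratioZ]). Intertwiners compose, and the ratio of determinants is
    multiplicative on operators preserving [X+] and [X-]; hence
    [g |-> det_ratio T *: T] is a representation on any group whose elements have
    such a [T]. For the Bruhat elements [T] is explicit: a permutation of the basis
    for [h_t], a diagonal operator for [u_r], the Fourier transform for [omega].

    The scalars come out as follows. For monomial operators the ratio of determinants
    is a product of signs over the half-system ([det_ratio_monomial]); this
    identifies it with [mu] on the permutation operators, so [mu] is a
    homomorphism, and it is 1 on the diagonal ones. The ratio [c0] for the
    Fourier transform is found from the group relations. The relation
    [omega ^ 2 = h_eps] gives condition (vii) for [c0], and [bruhat_relation],
    evaluated on one coordinate, gives condition (viii) for [c0]
    ([fourier_det_gauss]). Specializing (viii) to [t = 1] when [eps = -1], and to a
    skew matrix when [eps = 1], expresses [c0] through a Gauss sum and yields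
    [c0 = f] ([weil_fE]). The remaining conditions for a data are formal properties
    of [beta], and uniqueness holds because the Bruhat elements generate.

    If [B] is local, reduce matrices modulo the nonunits, to the residue field [F]. An
    element with invertible upper left entry is visibly a product of Bruhat elements
    ([unit_corner_SSL]). In general Gaussian elimination brings the lower left
    block to a projection [E] of rank [r], and multiplication by a suitable [u_R]
    makes the upper left entry invertible as soon as [F] carries an invertible
    [eps]-symmetric matrix commuting with [E] ([rank_criterion]). The identity
    serves when [eps = -1], the scalar [b^* - b] when [eps = 1] and the involution is
    unramified; when [eps = 1] and it is ramified one needs an alternating matrix, so
    [r] must be even. In that last case a reflection changes the parity of [r], and
    the determinant over [F], equal to 1 on the Bruhat elements and to -1 on
    reflections, shows that the parity is an invariant of the coset: the index is 2.
    Twisting by this sign then destroys uniqueness on the larger group. *)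

(** * Involutions and the groups generated by the Bruhat elements *)

Lemma unitr_of_sqr1 (A : unitRingType) (x : A) : x * x = 1 -> x \is a GRing.unit.
Proof. by move=> xx; apply/unitrP; exists x. Qed.

Lemma unipotent_unit (A : unitRingType) (c : A) : c * c = 0 -> 1 + c \is a GRing.unit.
Proof.
move=> cc; apply/unitrP; exists (1 - c); split.
  by rewrite mulrBl mul1r mulrDr mulr1 cc addr0 addrK.
by rewrite mulrBr mulr1 mulrDl mul1r cc addr0 addrK.
Qed.

Section Involution.
Variables (A : finUnitRingType) (star : A -> A).
Hypothesis hs : is_involution star.

Lemma starD x y : star (x + y) = star x + star y.
Proof. by case: hs. Qed.
Lemma star1 : star 1 = 1. Proof. by case: hs. Qed.
Lemma starM x y : star (x * y) = star y * star x. Proof. by case: hs. Qed.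
Lemma starK : involutive star. Proof. by case: hs. Qed.
Lemma star0 : star 0 = 0.
Proof. by apply: (addrI (star 0)); rewrite -starD !addr0. Qed.
Lemma starN x : star (- x) = - star x.
Proof. by apply/eqP; rewrite -addr_eq0 -starD addNr star0. Qed.
Lemma starB x y : star (x - y) = star x - star y.
Proof. by rewrite starD starN. Qed.
Lemma star_sum (J : Type) (r : seq J) (p : pred J) (F : J -> A) :
  star (\sum_(i <- r | p i) F i) = \sum_(i <- r | p i) star (F i).
Proof. exact: (big_morph star starD star0). Qed.
Lemma star_nat n : star n%:R = n%:R.
Proof. by elim: n => [|n IHn]; rewrite ?star0 // !mulrS starD star1 IHn. Qed.
Lemma star_unit t : t \is a GRing.unit -> star t \is a GRing.unit.
Proof.
by move=> ut; apply/unitrP; exists (star t^-1); rewrite -!starM mulVr // mulrV // star1.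
Qed.
Lemma starV t : t \is a GRing.unit -> star t^-1 = (star t)^-1.
Proof.
move=> ut; apply: (mulIr (star_unit ut)).
by rewrite -starM mulrV // star1 mulVr // star_unit.
Qed.

End Involution.

Section SpecialGroup.
Variables (A : finUnitRingType) (star : A -> A) (eps : int).
Hypothesis hs : is_involution star.
Hypothesis heps : eps = 1 \/ eps = -1.

Local Notation SL := (SLstar star eps).
Local Notation SSL := (SSLstar star eps).
Local Notation sym := (eps_sym star eps).
Local Notation star2 := (@star_trmx A star 1).
Local Notation E := (eps%:~R : A).

Lemma epsM : E * E = 1.
Proof. by case: heps => ->; rewrite ?mulrNz mulr1z ?mulrNN mulr1. Qed.
Lemma epsC x : E * x = x * E.
Proof. by case: heps => ->; rewrite ?mulrNz mulr1z ?mulrN1 ?mulN1r ?mulr1 ?mul1r. Qed.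
Lemma star_eps : star E = E.
Proof. by case: heps => ->; rewrite ?mulrNz mulr1z ?(starN hs) (star1 hs). Qed.
Lemma epsK x : E * (E * x) = x.
Proof. by rewrite mulrA epsM mul1r. Qed.

Lemma eps_symP s : reflect (star s = - (E * s)) (sym s).
Proof.
rewrite /eps_sym addrC addr_eq0; apply: (iffP eqP) => [h|->].
  by rewrite -[star s]epsK h mulrN.
by rewrite mulrN epsK.
Qed.

Lemma eps_symN s : sym s -> sym (- s).
Proof. by move=> /eps_symP hr; apply/eps_symP; rewrite (starN hs) hr mulrN. Qed.
Lemma eps_symE s : sym s -> sym (E * s).
Proof.
move=> /eps_symP hr; apply/eps_symP.
by rewrite (starM hs) hr star_eps mulNr -mulrA -(epsC s).
Qed.
Lemma eps_unit : E \is a GRing.unit.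
Proof. by apply: unitr_of_sqr1; exact: epsM. Qed.
Lemma epsV : E^-1 = E.
Proof. by apply: (mulrI eps_unit); rewrite mulrV ?eps_unit // epsM. Qed.
Lemma eps_symV s : sym s -> s \is a GRing.unit -> sym s^-1.
Proof.
move=> /eps_symP hr us; apply/eps_symP.
by rewrite (starV hs) // hr invrN invrM ?eps_unit // epsV -(epsC s^-1).
Qed.

Lemma mx22_ent (M : matring A 1) :
  M = mx22 ((M : 'M_2) 0 0) ((M : 'M_2) 0 1) ((M : 'M_2) 1 0) ((M : 'M_2) 1 1).
Proof.
apply/matrixP=> i j; rewrite !mxE /=.
by case: i j => [[|[|?]] ?] [[|[|?]] ?] //=;
   congr (M _ _); apply: val_inj.
Qed.

Lemma mx22_inj a b c d a' b' c' d' :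
  mx22 a b c d = mx22 a' b' c' d' :> matring A 1 -> [/\ a = a', b = b', c = c' & d = d'].
Proof.
move=> /matrixP h; split; [move: (h 0 0) | move: (h 0 1) | move: (h 1 0) | move: (h 1 1)];
  by rewrite !mxE.
Qed.

Lemma val_mx22 (g : {unit matring A 1}) :
  val g = mx22 (ent g 0 0) (ent g 0 1) (ent g 1 0) (ent g 1 1).
Proof. exact: mx22_ent. Qed.

Lemma ent_mx22 (g : {unit matring A 1}) a b c d : val g = mx22 a b c d ->
  [/\ ent g 0 0 = a, ent g 0 1 = b, ent g 1 0 = c & ent g 1 1 = d].
Proof. by rewrite val_mx22 => /mx22_inj. Qed.

Lemma ent_mul (g k : {unit matring A 1}) i j :
  ent (g * k)%g i j = ent g i 0 * ent k 0 j + ent g i 1 * ent k 1 j.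
Proof.
rewrite /ent FinRing.val_unitM (mx22_ent (val g)) (mx22_ent (val k)) mul_mx22 !mxE.
by case: i j => [[|[|?]] ?] [[|[|?]] ?].
Qed.

Lemma star_mx22 a b c d :
  star2 (mx22 a b c d) = mx22 (star a) (star c) (star b) (star d).
Proof.
apply/matrixP=> i j; rewrite !mxE /=.
by case: i j => [[|[|?]] ?] [[|[|?]] ?].
Qed.

Lemma star2_involution : is_involution star2.
Proof.
split=> [a b||a b|a].
- by apply/matrixP=> i j; rewrite !mxE starD.
- by rewrite -mx22_1 star_mx22 (star1 hs) (star0 hs).
- by rewrite (mx22_ent a) (mx22_ent b) mul_mx22 !star_mx22 mul_mx22 !(starD hs) !(starM hs).
- by apply/matrixP=> i j; rewrite !mxE (starK hs).
Qed.

Definition Jmx : matring A 1 := mx22 0 1 E 0.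

(** The three defining equations are the entries of [g^* J g = J], the fourth entry
    being the adjoint of the third equation; in this form closure under
    products is immediate. *)
Lemma SLstarP (g : {unit matring A 1}) :
  reflect (star2 (val g) * Jmx * val g = Jmx) (g \in SL).
Proof.
rewrite inE val_mx22 star_mx22 !mul_mx22 !mulr0 !mulr1 !addr0 !add0r.
set a := ent g 0 0; set b := ent g 0 1; set c := ent g 1 0; set d := ent g 1 1.
apply: (iffP and3P) => [[/eqP h1 /eqP h2 /eqP h3]|/mx22_inj [h1 h2 h3 h4]].
  have h4 : star d * E * a + star b * c = E.
    by move: (congr1 ( *%R E) h3); rewrite mulr1 mulrDr !mulrA epsM mul1r (epsC (star d)).
  rewrite /Jmx; congr mx22 => //.
  - by rewrite h1 -epsC addrN.
  - move: (congr1 star h3); rewrite (star1 hs) (starD hs) !(starM hs) !(starK hs).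
    by rewrite star_eps addrC -(epsC b) mulrA.
  - by rewrite h2 -epsC addrN.
split; apply/eqP.
- by apply/eqP; rewrite -addr_eq0 addrC epsC h1.
- by apply/eqP; rewrite -addr_eq0 addrC epsC h4.
move: (congr1 ( *%R E) h3); rewrite epsM mulrDr !mulrA (epsC (star d)).
by rewrite -(mulrA _ E E) epsM mulr1.
Qed.

Lemma SL1 : 1%g \in SL.
Proof. by apply/SLstarP; rewrite (star1 star2_involution) mul1r mulr1. Qed.

Lemma SLM g k : g \in SL -> k \in SL -> (g * k)%g \in SL.
Proof.
move=> /SLstarP hg /SLstarP hk; apply/SLstarP; rewrite /= (starM star2_involution).
by rewrite -[RHS]hk -[in RHS]hg !mulrA.
Qed.

Lemma SL_group : group_set SL.
Proof. by apply/group_setP; split; [exact: SL1 | move=> g k; apply: SLM]. Qed.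

Lemma omega_SL : bruhat_omega A eps \in SL.
Proof.
apply/SLstarP; rewrite (bruhat_omegaE _ heps) star_mx22 !mul_mx22 /Jmx.
by rewrite !(star0 hs) !(star1 hs) star_eps !(mulr0,mul0r,mulr1,mul1r,addr0,add0r) epsM.
Qed.

Lemma h_SL t : t \is a GRing.unit -> bruhat_h star t \in SL.
Proof.
move=> ut; apply/SLstarP; rewrite bruhat_hE // star_mx22 !mul_mx22 /Jmx.
rewrite !(star0 hs) (starV hs) ?(star_unit hs) // (starK hs).
by rewrite !(mulr0,mul0r,mulr1,mul1r,addr0,add0r) -epsC -mulrA mulVr // mulr1 mulrV ?(star_unit hs).
Qed.

Lemma u_SL r : sym r -> bruhat_u r \in SL.
Proof.
move=> /eps_symP sr; apply/SLstarP; rewrite bruhat_uE star_mx22 !mul_mx22 /Jmx.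
rewrite !(star0 hs) !(star1 hs) sr.
by rewrite !(mulr0,mul0r,mulr1,mul1r,addr0,add0r) addrN.
Qed.

Lemma omega_SSL : bruhat_omega A eps \in SSL.
Proof. by apply/mem_gen/setU1P; left. Qed.
Lemma h_SSL t : t \is a GRing.unit -> bruhat_h star t \in SSL.
Proof.
by move=> ut; apply/mem_gen/setU1P; right; apply/setUP; left; apply/imsetP; exists t; rewrite ?inE.
Qed.
Lemma u_SSL r : sym r -> bruhat_u r \in SSL.
Proof.
by move=> sr; apply/mem_gen/setU1P; right; apply/setUP; right; apply/imsetP; exists r; rewrite ?inE.
Qed.

Lemma SSL_sub_group (G : {group {unit matring A 1}}) :
  bruhat_omega A eps \in G ->
  (forall t, t \is a GRing.unit -> bruhat_h star t \in G) ->
  (forall r, sym r -> bruhat_u r \in G) -> SSL \subset G.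
Proof.
move=> ho hh hu; rewrite /SSLstar gen_subG; apply/fintype.subsetP=> g /setU1P[->//|/setUP[]] /imsetP[x].
  by rewrite inE => hx ->; apply: hh.
by rewrite inE => hx ->; apply: hu.
Qed.

Lemma SSL_sub_SL : SSL \subset SL.
Proof. exact: (SSL_sub_group (G := Group SL_group)) omega_SL h_SL u_SL. Qed.

Lemma omega_sqr : (bruhat_omega A eps * bruhat_omega A eps)%g = bruhat_h star E.
Proof.
apply: val_inj; rewrite FinRing.val_unitM (bruhat_hE hs eps_unit).
rewrite (bruhat_omegaE _ heps) mul_mx22 star_eps epsV.
by congr mx22; rewrite !(mulr0,mul0r,mulr1,mul1r,addr0,add0r).
Qed.

(** For an invertible [t] this relation ties [omega] to the diagonal element of
    [- t]. In the Weil representation it becomes a Gauss sum identity; under a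
    determinant character it forces the value at [omega]. *)
Lemma bruhat_relation t : sym t -> t \is a GRing.unit ->
  (bruhat_omega A eps * bruhat_u t^-1%R * bruhat_omega A eps * bruhat_u (- (E * t))%R =
   bruhat_u (E * t)%R * bruhat_h star (- t)%R * bruhat_omega A eps)%g.
Proof.
move=> /eps_symP st ut; have uNt : - t \is a GRing.unit by rewrite unitrN.
apply: val_inj; move: (bruhat_uE t^-1) (bruhat_uE (- (E * t))) (bruhat_uE (E * t)).
move: (bruhat_hE hs uNt) (bruhat_omegaE A heps).
move: (bruhat_u t^-1) (bruhat_u (- (E * t))) (bruhat_u (E * t)) => u1 u2 u3.
move: (bruhat_h star (- t)) (bruhat_omega A eps) => h w eh ew e1 e2 e3.
rewrite !FinRing.val_unitM eh ew e1 e2 e3 !mul_mx22.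
have -> : (star (- t))^-1 = t^-1 * E.
  by rewrite (starN hs) st opprK invrM ?eps_unit // epsV.
have ct : E * t^-1 * E = t^-1 by rewrite -mulrA -epsC epsK.
congr mx22; rewrite !(mulr0,mul0r,mulr1,mul1r,addr0,add0r).
- by rewrite mulrA mulrK // -mulrA epsM mulr1.
- by rewrite mulrN epsK.
- by rewrite (epsC t^-1).
- by rewrite ct mulrN (epsC t) mulKr // addNr.
Qed.

Lemma SSL_mul g k : g \in SSL -> k \in SSL -> (g * k)%g \in SSL.
Proof. exact: groupM. Qed.
Lemma SSL_inv g : g \in SSL -> (g^-1)%g \in SSL.
Proof. by move=> h; rewrite groupV. Qed.
Lemma SL_inv g : g \in SL -> (g^-1)%g \in SL.
Proof. exact: (@groupVr _ (Group SL_group)). Qed.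
Lemma SSL_cancell g k : g \in SSL -> (g * k)%g \in SSL -> k \in SSL.
Proof. by move=> gS; rewrite groupMl. Qed.
Lemma SSL_cancelr g k : k \in SSL -> (g * k)%g \in SSL -> g \in SSL.
Proof. by move=> kS; rewrite groupMr. Qed.

(** Conjugation by [omega] exchanges upper and lower unitriangular elements. *)
Lemma lower_SSL x : sym x -> exists2 l, l \in SSL & val l = mx22 1 0 x 1.
Proof.
move=> hx; exists (bruhat_omega A eps * bruhat_u (E * x)%R * (bruhat_omega A eps)^-1)%g.
  by rewrite !SSL_mul ?SSL_inv ?omega_SSL ?u_SSL ?eps_symE.
have := bruhat_uE (E * x); have := bruhat_omegaE A heps.
move: (bruhat_omega A eps) (bruhat_u (E * x)) => w u ew eu.
apply: (mulIr (valP w)); rewrite -!FinRing.val_unitM mulgKV FinRing.val_unitM ew eu !mul_mx22.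
by congr mx22; rewrite !(mulr0,mul0r,mulr1,mul1r,addr0,add0r) ?epsK.
Qed.

(** The big cell: pivoting on the unit [a] writes the element as a product of a
    lower unitriangular, a diagonal and an upper unitriangular element, and the
    isometry equations make the off-diagonal entries [eps]-symmetric. *)
Lemma unit_corner_SSL g : g \in SL -> ent g 0 0 \is a GRing.unit -> g \in SSL.
Proof.
move=> gS ua; set a := ent g 0 0 in ua *.
have usa := star_unit hs ua.
have := gS; rewrite inE -/a => /and3P[/eqP h1 _ _].
have hx : sym (- (ent g 1 0 * a^-1)).
  apply/eps_symN/eps_symP; rewrite (starM hs) (starV hs) //.
  apply: (mulrI usa); rewrite (mulVKr usa) mulrN (mulrA _ E) -(epsC (star a)) -(mulrA E).
  by rewrite (mulrA (star a)) h1 mulNr mulrN opprK (mulrK ua) epsK.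
have [l lS el] := lower_SSL hx.
set k := (l * g)%g; have kSL : k \in SL by rewrite SLM // (fintype.subsetP SSL_sub_SL).
have ek : val k = mx22 a (ent g 0 1) 0 (ent k 1 1).
  have ek : val k = mx22 1 0 (- (ent g 1 0 * a^-1)) 1 * val g by rewrite FinRing.val_unitM el.
  rewrite [LHS]val_mx22; rewrite (val_mx22 g) mul_mx22 in ek.
  have [-> -> -> _] := ent_mx22 ek.
  by rewrite !mul1r !mul0r !addr0 mulNr mulrVK // addNr.
have [e00 e01 e10 _] := ent_mx22 ek; set d := ent k 1 1 in ek.
apply: (SSL_cancell lS); rewrite -/k.
have := kSL; rewrite inE e00 e01 e10 -/d => /and3P[_ /eqP k2 /eqP k3].
have dE : d = (star a)^-1.
  have da : star d * a = 1 by rewrite -k3 mulr0 addr0.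
  rewrite -[d](starK hs) -(starV hs) //; congr star.
  by apply: (mulIr ua); rewrite da mulVr.
have hb : sym (a^-1 * ent g 0 1).
  apply/eps_symP; rewrite (starM hs) (starV hs) // -dE.
  by rewrite k2 dE (starV hs) // (starK hs) mulrA.
suff -> : k = (bruhat_h star a * bruhat_u (a^-1 * ent g 0 1)%R)%g.
  by apply: SSL_mul; [exact: h_SSL | exact: u_SSL].
apply: val_inj; rewrite [RHS]FinRing.val_unitM; apply: (etrans ek).
have -> := bruhat_hE hs ua; have -> := bruhat_uE (a^-1 * ent g 0 1).
rewrite mul_mx22 -dE.
by rewrite !(mulr0,mul0r,mulr1,mul1r,addr0,add0r) mulVKr.
Qed.

End SpecialGroup.

(** * Determinants on stable subspaces *)

Section Determinants.
Variables (C : fieldType) (X : vectType C).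
Implicit Types (U : {vspace X}) (f g : 'End(X)).

(** Independence of the basis: [vbasis U] is an unspecified basis, whereas the
    determinants needed later are visible only in well-chosen ones. *)
Lemma det_restr_basis U k (b : k.-tuple X) f (M : 'M_k) : basis_of U b ->
  (forall j : 'I_k, f b`_j = \sum_(i < k) M i j *: b`_i) -> det_restr U f = \det M.
Proof.
move=> hb hf; have ek := size_basis hb; subst k.
have hv : basis_of U (vbasis U) := vbasisP U.
have mb (i : 'I_(\dim U)) : b`_i \in U by apply: (basis_mem hb); rewrite mem_nth // size_tuple.
pose N := \matrix_(i < \dim U, j < \dim U) coord (vbasis U) i (f (vbasis U)`_j).
pose Q := \matrix_(i < \dim U, j < \dim U) coord (vbasis U) i b`_j.
pose Q' := \matrix_(i < \dim U, j < \dim U) coord b i (vbasis U)`_j.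
have QM : Q *m M = N *m Q.
  apply/matrixP=> i j; rewrite !mxE; transitivity (coord (vbasis U) i (f b`_j)).
    by rewrite hf linear_sum; apply: eq_bigr => k _; rewrite linearZ /= !mxE mulrC.
  rewrite {1}(coord_basis hv (mb j)) !linear_sum; apply: eq_bigr => k _.
  by rewrite !linearZ /= !mxE mulrC.
have Q'Q : Q' *m Q = 1%:M.
  apply/matrixP=> i j; rewrite !mxE eq_sym -(coord_free _ _ (basis_free hb)).
  symmetry; rewrite {1}(coord_basis hv (mb j)) linear_sum; apply: eq_bigr => k _.
  by rewrite linearZ /= !mxE mulrC.
have /andP[nQ' nQ] : (\det Q' != 0) && (\det Q != 0).
  by rewrite -negb_or -mulf_eq0 -det_mulmx Q'Q det1 oner_eq0.
by apply: (mulIf nQ); rewrite -[det_restr U f]/(\det N) -det_mulmx -QM det_mulmx mulrC.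
Qed.

Lemma det_restrM U f g : {in U, forall x, g x \in U} ->
  det_restr U (f \o g)%VF = det_restr U f * det_restr U g.
Proof.
move=> hg; rewrite /det_restr -det_mulmx; congr (\det _).
apply/matrixP=> i j; rewrite !mxE comp_lfunE.
have mv : (vbasis U)`_j \in U by apply: (basis_mem (vbasisP U)); rewrite mem_nth // size_tuple.
rewrite {1}(coord_vbasis (hg _ mv)) !linear_sum; apply: eq_bigr => k _.
by rewrite !linearZ /= !mxE mulrC.
Qed.

Lemma det_restr1 U : det_restr U \1%VF = 1.
Proof.
rewrite -(det1 C (\dim U)); apply: (det_restr_basis (vbasisP U)) => j.
rewrite id_lfunE (bigD1 j) //= big1 => [|i ij]; first by rewrite mxE eqxx scale1r addr0.
by rewrite mxE (negPf ij) scale0r.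
Qed.

Lemma det_restrZ U a f : det_restr U (a *: f) = a ^+ \dim U * det_restr U f.
Proof.
rewrite /det_restr -detZ; congr (\det _); apply/matrixP=> i j.
by rewrite !mxE scale_lfunE linearZ.
Qed.

Lemma det_restr_neq0 U f : lker f = 0%VS -> {in U, forall x, f x \in U} ->
  det_restr U f != 0.
Proof.
move=> kf hf; have : det_restr U (f^-1 \o f)%VF != 0.
  by rewrite lker0_compVf ?kf // det_restr1 oner_neq0.
by rewrite det_restrM // mulf_eq0 negb_or => /andP[].
Qed.

End Determinants.

Section BasisCoordinates.
Variables (C : fieldType) (X : vectType C) (P : finType) (e : P -> X).
Hypothesis he : basis_of fullv (codom e).

Definition bcoord (v : P) : {scalar X} := coord (codom_tuple e) (enum_rank v).

Lemma nth_basis v : (codom_tuple e)`_(enum_rank v) = e v.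
Proof. by rewrite nth_codom enum_rankK. Qed.

Lemma bcoord_basis v w : bcoord v (e w) = (v == w)%:R.
Proof.
rewrite /= -(nth_basis w) coord_free ?(basis_free he) //.
by rewrite (inj_eq enum_rank_inj) eq_sym.
Qed.

Lemma bcoord_sum x : x = \sum_v bcoord v x *: e v.
Proof.
have hb : basis_of fullv (codom_tuple e) by [].
rewrite {1}(coord_basis hb (memvf x)).
rewrite (reindex_onto enum_rank enum_val) => [|i _]; last by rewrite enum_valK.
apply: eq_big => v; first by rewrite enum_rankK eqxx.
by rewrite nth_basis.
Qed.

Lemma basis_eq (T T' : 'End(X)) : (forall v, T (e v) = T' (e v)) -> T = T'.
Proof.
move=> h; apply/lfunP=> x; rewrite (bcoord_sum x) !linear_sum.
by apply: eq_bigr => v _; rewrite !linearZ /= h.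
Qed.

Lemma bcoord_eq x y : (forall v, bcoord v x = bcoord v y) -> x = y.
Proof.
by move=> h; rewrite (bcoord_sum x) (bcoord_sum y); apply: eq_bigr => v _; rewrite h.
Qed.

Definition basis_map (phi : P -> X) : 'End(X) :=
  linfun (sval (linear_of_free (codom e) [seq phi v | v : P])).

Lemma basis_mapE phi v : basis_map phi (e v) = phi v.
Proof.
rewrite lfunE /=; case: linear_of_free => h /= hP.
have {hP} := hP (basis_free he); rewrite !size_map => /(_ erefl).
by rewrite /codom /image_mem -map_comp => /eq_in_map; apply; rewrite mem_enum.
Qed.

Lemma basis_lker0 (T T' : 'End(X)) : (forall v, T' (T (e v)) = e v) -> lker T = 0%VS.
Proof.
move=> h; apply/eqP/lker0P=> x y xy.
have TT : (T' \o T)%VF = \1%VF by apply: basis_eq => v; rewrite comp_lfunE id_lfunE h.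
by rewrite -[x]id_lfunE -[y]id_lfunE -TT !comp_lfunE xy.
Qed.

End BasisCoordinates.

(** * The two parity eigenspaces *)

Section ParitySpaces.
Variables (C : fieldType) (X : vectType C) (P : finZmodType) (e : P -> X).
Hypothesis he : basis_of fullv (codom e).
Hypothesis two_neq0 : 2%:R != 0 :> C.
Variable I : {set P}.
Hypothesis I0 : 0 \notin I.
Hypothesis IN : forall v, v != 0 -> (- v \in I) = (v \notin I).

Let fe : free (codom e) := basis_free he.
Local Notation par := (parity e).
Local Notation Xp := (Xplus e).
Local Notation Xm := (Xminus e).
Local Notation cf := (bcoord e).

Lemma bcoord_parity v x : cf v (par x) = cf (- v) x.
Proof.
rewrite {1}(bcoord_sum he x) !linear_sum {2}(bcoord_sum he x) linear_sum.
apply: eq_bigr => w _; rewrite !linearZ /= parityE // !(bcoord_basis he).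
by rewrite -eqr_oppLR.
Qed.

Lemma mem_leigenspace (f : 'End(X)) a x :
  (x \in passmx.leigenspace f a) = (f x == a *: x).
Proof.
by rewrite memv_ker add_lfunE opp_lfunE scale_lfunE id_lfunE subr_eq0.
Qed.

Lemma XplusP x : reflect (par x = x) (x \in Xp).
Proof. by rewrite mem_leigenspace scale1r; apply: eqP. Qed.
Lemma XminusP x : reflect (par x = - x) (x \in Xm).
Proof. by rewrite mem_leigenspace scaleN1r; apply: eqP. Qed.

(** The vectors [plus_vec v] and [minus_vec v], with [v] in the half-system, span
    the two eigenspaces up to the extra vector [e 0] of the first one. *)
Definition plus_vec (v : P) : X := e v + e (- v).
Definition minus_vec (v : P) : X := e v - e (- v).

Lemma half_neq0 v : v \in I -> v != 0.
Proof. by apply: contraTneq => ->. Qed.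

Lemma half_neqN v w : v \in I -> w \in I -> (v == - w) = false.
Proof.
move=> vI wI; apply/negP=> /eqP vE; move: vI.
by rewrite vE IN ?half_neq0 // wI.
Qed.

Lemma sum_half (V : zmodType) (F : P -> V) :
  \sum_v F v = F 0 + \sum_(v in I) (F v + F (- v)).
Proof.
rewrite (bigD1 0) //= (bigID (mem I)) /= big_split /=; congr (_ + (_ + _)).
  by apply: eq_bigl => v; case: eqP => [->|]; rewrite ?(negPf I0).
rewrite [RHS](reindex_inj oppr_inj) /=; apply: eq_big => [v|v _]; last by rewrite opprK.
case: (eqVneq v 0) => [->|v0] /=; first by rewrite oppr0 (negPf I0).
by rewrite IN.
Qed.

Definition plus_basis : (1 + #|I|).-tuple X :=
  cons_tuple (e 0) [tuple plus_vec (enum_val j) | j < #|I|].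
Definition minus_basis : #|I|.-tuple X := [tuple minus_vec (enum_val j) | j < #|I|].

Lemma nth_minus (j : 'I_#|I|) : minus_basis`_j = minus_vec (enum_val j).
Proof. by rewrite -tnth_nth tnth_mktuple. Qed.
Lemma nth_plus0 : plus_basis`_(lshift #|I| (ord0 : 'I_1)) = e 0.
Proof. by []. Qed.
Lemma nth_plusS (j : 'I_#|I|) : plus_basis`_(rshift 1 j) = plus_vec (enum_val j).
Proof.
transitivity [tuple plus_vec (enum_val l) | l < #|I|]`_j; first by [].
by rewrite -tnth_nth tnth_mktuple.
Qed.

Lemma sum_plus (k : 'I_(1 + #|I|) -> C) :
  \sum_i k i *: plus_basis`_i =
  k (lshift #|I| ord0) *: e 0 + \sum_j k (rshift 1 j) *: plus_vec (enum_val j).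
Proof.
rewrite big_split_ord big_ord1 nth_plus0; congr (_ + _).
by apply: eq_bigr => j _; rewrite nth_plusS.
Qed.

Lemma plus_vec_mem v : plus_vec v \in Xp.
Proof. by apply/XplusP; rewrite linearD /= !parityE // opprK addrC. Qed.
Lemma minus_vec_mem v : minus_vec v \in Xm.
Proof. by apply/XminusP; rewrite linearB /= !parityE // opprK opprB. Qed.
Lemma e0_mem : e 0 \in Xp.
Proof. by apply/XplusP; rewrite parityE // oppr0. Qed.

Lemma bcoord_half (i j : 'I_#|I|) a :
  cf (enum_val i) (e (enum_val j) + a *: e (- enum_val j)) = (i == j)%:R.
Proof.
rewrite linearD linearZ /= !(bcoord_basis he) half_neqN ?enum_valP //.
by rewrite mulr0 addr0 (inj_eq enum_val_inj).
Qed.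

Lemma minus_basisP : basis_of Xm minus_basis.
Proof.
have fm : free minus_basis.
  apply/freeP => k hk i; have := congr1 (cf (enum_val i)) hk.
  rewrite linear0 linear_sum (bigD1 i) //= big1 => [|j ji].
    rewrite addr0 nth_minus linearZ /= /minus_vec -scaleN1r bcoord_half eqxx.
    by rewrite mulr1.
  by rewrite nth_minus linearZ /= /minus_vec -scaleN1r bcoord_half eq_sym (negPf ji) mulr0.
rewrite basisEfree fm /=; apply/andP; split.
  by apply/span_subvP=> x /mapP[j _ ->]; apply: minus_vec_mem.
rewrite -(eqP fm); apply: dimvS; apply/subvP=> x /XminusP hx.
have cN v : cf (- v) x = - cf v x by rewrite -bcoord_parity hx linearN.
have c0 : cf 0 x = 0.
  have /eqP := cN 0; rewrite oppr0 -addr_eq0 -mulr2n -mulr_natl mulf_eq0.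
  by rewrite (negPf two_neq0) => /eqP.
rewrite (bcoord_sum he x) sum_half c0 scale0r add0r rpred_sum // => v vI.
rewrite cN scaleNr -scalerBr rpredZ // memv_span //.
apply/mapP; exists (enum_rank_in vI v); first by rewrite mem_enum.
by rewrite enum_rankK_in.
Qed.

Lemma plus_basisP : basis_of Xp plus_basis.
Proof.
have fp : free plus_basis.
  apply/freeP => k; rewrite sum_plus => hk.
  have k0 : k (lshift #|I| ord0) = 0.
    have := congr1 (cf 0) hk.
    rewrite linear0 linearD linear_sum linearZ /= (bcoord_basis he) eqxx mulr1.
    rewrite big1 ?addr0 // => j _; rewrite linearZ linearD /= !(bcoord_basis he).
    have j0 := half_neq0 (enum_valP j).
    by rewrite -eqr_oppLR oppr0 eq_sym (negPf j0) addr0 mulr0.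
  move=> i; case: (split_ordP i) => [j ->|j ->]; first by rewrite (ord1 j).
  move: hk; rewrite k0 scale0r add0r => /(congr1 (cf (enum_val j))).
  rewrite linear0 linear_sum (bigD1 j) //= big1 => [|l lj].
    rewrite addr0 linearZ /= /plus_vec -[e (- _)]scale1r bcoord_half eqxx.
    by rewrite mulr1.
  by rewrite linearZ /= /plus_vec -[e (- _)]scale1r bcoord_half eq_sym (negPf lj) mulr0.
rewrite basisEfree fp andTb; apply/andP; split.
  apply/span_subvP=> x; rewrite inE => /orP[/eqP->|/mapP[j _ ->]]; first exact: e0_mem.
  exact: plus_vec_mem.
rewrite -(eqP fp); apply: dimvS; apply/subvP=> x /XplusP hx.
have cN v : cf (- v) x = cf v x by rewrite -bcoord_parity hx.
rewrite (bcoord_sum he x) sum_half; apply: rpredD.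
  by rewrite rpredZ // memv_span // inE eqxx.
apply: rpred_sum => v vI.
rewrite cN -scalerDr rpredZ // memv_span // inE; apply/orP; right.
apply/mapP; exists (enum_rank_in vI v); first by rewrite mem_enum.
by rewrite enum_rankK_in.
Qed.

Lemma dim_Xminus : \dim Xm = #|I|.
Proof. by rewrite -(size_basis minus_basisP). Qed.
Lemma dim_Xplus : \dim Xp = #|I|.+1.
Proof. by rewrite (size_basis plus_basisP). Qed.

Definition commutes_parity (T : 'End(X)) := forall x, T (par x) = par (T x).

Lemma commutes_parity_basis (T : 'End(X)) :
  (forall v, T (e (- v)) = par (T (e v))) -> commutes_parity T.
Proof.
move=> h x; suff: (T \o par)%VF = (par \o T)%VF by move/lfunP/(_ x); rewrite !comp_lfunE.
by apply: (basis_eq he) => v; rewrite !comp_lfunE parityE.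
Qed.

Lemma stable_Xplus T : commutes_parity T -> {in Xp, forall x, T x \in Xp}.
Proof. by move=> h x /XplusP hx; apply/XplusP; rewrite -h hx. Qed.
Lemma stable_Xminus T : commutes_parity T -> {in Xm, forall x, T x \in Xm}.
Proof. by move=> h x /XminusP hx; apply/XminusP; rewrite -h hx linearN. Qed.

Lemma det_ratioM T T' : commutes_parity T' ->
  det_ratio e (T \o T')%VF = det_ratio e T * det_ratio e T'.
Proof.
move=> h; rewrite /det_ratio (det_restrM _ (stable_Xplus h)) (det_restrM _ (stable_Xminus h)).
by rewrite invfM mulrACA.
Qed.

Lemma det_ratio1 : det_ratio e \1%VF = 1.
Proof. by rewrite /det_ratio !det_restr1 mulr1 invr1. Qed.

Lemma det_ratio_neq0 T : lker T = 0%VS -> commutes_parity T -> det_ratio e T != 0.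
Proof.
move=> kT hT; rewrite mulf_neq0 ?invr_neq0 // det_restr_neq0 //.
  exact: stable_Xplus.
exact: stable_Xminus.
Qed.

(** [X+] has one dimension more than [X-], so [det_ratio] is homogeneous of
    degree [-1] and [det_ratio T *: T] does not see the scaling of [T]. *)
Lemma det_ratioZ a T : a != 0 -> det_ratio e (a *: T) = a^-1 * det_ratio e T.
Proof.
move=> a0; rewrite /det_ratio !det_restrZ dim_Xplus dim_Xminus exprS.
have ak : a ^+ #|I| != 0 by rewrite expf_neq0.
by rewrite !invfM -!mulrA (mulrCA _ (a ^+ _)) mulKf.
Qed.

(** A monomial operator acts on the [plus_vec v] and on the [minus_vec v] by
    matrices that differ only in the signs of the columns whose image leaves the
    half-system. So the ratio is the product of these signs, although the
    determinants themselves involve the sign of a permutation and all the [c v]. *)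
Lemma det_ratio_monomial (T : 'End(X)) (c : P -> C) (Y : P -> P) :
  (forall v, T (e v) = c v *: e (Y v)) -> (forall v, c (- v) = c v) -> c 0 = 1 ->
  (forall v, Y (- v) = - Y v) -> (forall v, v != 0 -> Y v != 0) -> Y 0 = 0 ->
  lker T = 0%VS ->
  det_ratio e T = (-1) ^+ #|[set v in I | Y v \notin I]|.
Proof.
move=> hT cN c0 YN Yn0 Y0 kT.
have pT : commutes_parity T.
  by apply: commutes_parity_basis => v; rewrite !hT linearZ /= parityE // cN YN.
pose sg v : C := if Y v \in I then 1 else -1.
(* [rep v] is the element of the half-system among [Y v] and [- Y v]. *)
pose rep v := if Y v \in I then Y v else - Y v.
have repI v : v \in I -> rep v \in I.
  by move=> /half_neq0/Yn0 hv; rewrite /rep; case: ifPn => //; rewrite -IN.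
pose ix (j : 'I_#|I|) := enum_rank_in (enum_valP j) (rep (enum_val j)).
have ixE j : enum_val (ix j) = rep (enum_val j).
  by rewrite enum_rankK_in // repI // enum_valP.
pose Mp : 'M[C]_#|I| := \matrix_(i, j) (c (enum_val j) * (i == ix j)%:R).
pose D : 'rV[C]_#|I| := \row_j sg (enum_val j).
have eM : det_restr Xm T = \det (Mp *m diag_mx D).
  apply: (det_restr_basis minus_basisP) => j; rewrite nth_minus (bigD1 (ix j)) //=.
  rewrite big1 => [|i ij]; last first.
    by rewrite mul_mx_diag !mxE (negPf ij) mulr0 mul0r scale0r.
  rewrite addr0 mul_mx_diag !mxE eqxx mulr1 nth_minus ixE /minus_vec linearB /= !hT cN YN.
  rewrite -scalerBr -scalerA /sg /rep; case: ifP => _; first by rewrite scale1r.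
  by rewrite opprK scaleN1r opprB.
have eP : det_restr Xp T = \det (block_mx 1%:M 0 0 Mp : 'M_(1 + #|I|)).
  apply: (det_restr_basis plus_basisP) => j.
  rewrite (sum_plus (fun i => (block_mx 1%:M 0 0 Mp : 'M_(1 + #|I|)) i j)).
  case: (split_ordP j) => [j0 ->|k ->].
    rewrite (ord1 j0) nth_plus0 hT c0 Y0 block_mxEul mxE eqxx scale1r big1 ?addr0 // => i _.
    by rewrite block_mxEdl mxE scale0r.
  rewrite nth_plusS block_mxEur mxE scale0r add0r (bigD1 (ix k)) //=.
  rewrite big1 => [|i ij]; last by rewrite block_mxEdr mxE (negPf ij) mulr0 scale0r.
  rewrite addr0 block_mxEdr mxE eqxx mulr1 ixE /plus_vec linearD /= !hT cN YN.
  rewrite -scalerDr /rep; case: ifP => _ //.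
  by rewrite opprK addrC.
have np : \det Mp != 0.
  move: (det_restr_neq0 kT (stable_Xplus pT)).
  by rewrite eP det_ublock det1 mul1r.
rewrite /det_ratio eM eP det_ublock det1 mul1r det_mulmx mulKf // det_diag.
transitivity (\prod_(v in I) sg v).
  by rewrite [RHS]big_enum_val; apply: eq_bigr => i _; rewrite mxE.
rewrite (bigID (fun v => Y v \in I)) /= big1 => [|v /andP[_ hv]]; last by rewrite /sg hv.
rewrite mul1r (eq_bigr (fun=> -1)) => [|v /andP[_ /negPf hv]]; last by rewrite /sg hv.
by rewrite prodr_const; congr (_ ^+ _); apply: eq_card => v; rewrite !inE.
Qed.

End ParitySpaces.

(** * The standard sesquilinear form and the character [beta] *)

Section Sesquilinear.
Variables (B : finUnitRingType) (star : B -> B).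
Hypothesis hs : is_involution star.
Variable m : nat.
Local Notation A := (matring B m).
Local Notation P := (colspace B m).
Local Notation starA := (@star_trmx B star m).
Local Notation ds := (@dotstar B star m).
Implicit Types (x y z : P) (t : A).

Lemma star_trmx_involution : is_involution starA.
Proof.
split=> [a b||a b|a].
- by apply/matrixP=> i j; rewrite !mxE (starD hs).
- apply/matrixP=> i j; rewrite !mxE eq_sym.
  by case: (i == j); rewrite ?(star1 hs) ?(star0 hs).
- apply/matrixP=> i j; rewrite !mxE (star_sum hs); apply: eq_bigr => k _.
  by rewrite !mxE (starM hs).
- by apply/matrixP=> i j; rewrite !mxE (starK hs).
Qed.

Lemma dotstarDl x y z : ds (x + y) z = ds x z + ds y z.
Proof.
by rewrite -big_split; apply: eq_bigr => i _; rewrite mxE (starD hs) mulrDl.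
Qed.
Lemma dotstarDr x y z : ds x (y + z) = ds x y + ds x z.
Proof. by rewrite -big_split; apply: eq_bigr => i _; rewrite mxE mulrDr. Qed.
Lemma dotstarNl x y : ds (- x) y = - ds x y.
Proof.
by rewrite -sumrN; apply: eq_bigr => i _; rewrite mxE (starN hs) mulNr.
Qed.
Lemma dotstarNr x y : ds x (- y) = - ds x y.
Proof. by rewrite -sumrN; apply: eq_bigr => i _; rewrite mxE mulrN. Qed.
Lemma dotstar0r x : ds x 0 = 0.
Proof. by rewrite [LHS]big1 // => i _; rewrite mxE mulr0. Qed.
Lemma dotstar0l x : ds 0 x = 0.
Proof. by rewrite [LHS]big1 // => i _; rewrite mxE (star0 hs) mul0r. Qed.
Lemma star_dotstar x y : star (ds x y) = ds y x.
Proof.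
by rewrite (star_sum hs); apply: eq_bigr => i _; rewrite (starM hs) (starK hs).
Qed.

Lemma dotstarZl t x y : ds (t *: x) y = ds x (starA t *: y).
Proof.
transitivity (\sum_i \sum_k star ((x : 'cV_m.+1) k 0) * star ((t : 'M_m.+1) i k) * (y : 'cV_m.+1) i 0).
  apply: eq_bigr => i _; rewrite mxE (star_sum hs) mulr_suml.
  by apply: eq_bigr => k _; rewrite (starM hs).
rewrite exchange_big; apply: eq_bigr => k _; rewrite mxE mulr_sumr.
by apply: eq_bigr => i _; rewrite mxE mulrA.
Qed.

Lemma matring_unit2 : (2%:R : B) \is a GRing.unit -> (2%:R : A) \is a GRing.unit.
Proof.
move=> h2; have e2 : (2%:R : A) = ((2%:R)%:M : 'M_m.+1) by rewrite raddfMn.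
apply/unitrP; exists ((2%:R^-1)%:M : 'M_m.+1).
by rewrite e2; split; rewrite -[LHS]scalar_mxM ?mulVr ?mulrV.
Qed.

Definition unit_col (i : 'I_m.+1) (b : B) : P := \col_j (if j == i then b else 0).

Lemma dotstar_unit_col i b y : ds (unit_col i b) y = star b * (y : 'cV_m.+1) i 0.
Proof.
rewrite [LHS](bigD1 i) //= big1 ?addr0 => [|j ji]; first by rewrite mxE eqxx.
by rewrite mxE (negPf ji) (star0 hs) mul0r.
Qed.

End Sesquilinear.

Section PairingMatrix.
Variables (B : finUnitRingType) (star : B -> B).
Hypothesis hs : is_involution star.
Variables (m n : nat).
Hypothesis hm : m.+1 = (2 * n)%N.
Local Notation A := (matring B m).
Local Notation starA := (@star_trmx B star m).
Let hsA : is_involution starA := star_trmx_involution hs m.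

(** The coordinates [2k] and [2k+1] are paired, rather than [k] and [k+n], so that
    the skew matrix built from it preserves the span of the first [r] basis
    vectors for every even [r]. *)
Definition pairing : A := \matrix_(i, j) (~~ odd i && (j == i.+1 :> nat))%:R.
Local Notation N := pairing.

Lemma star_pairingE i j : (starA N : 'M_m.+1) i j = (~~ odd j && (i == j.+1 :> nat))%:R.
Proof. by rewrite !mxE (star_nat hs). Qed.

Lemma pairing_sqr : N * N = 0.
Proof.
apply/matrixP=> i j; rewrite !mxE big1 // => k _; rewrite !mxE.
by case: eqP => [->|_]; rewrite ?andbF ?mul0r //= andbT; case: odd; rewrite ?mul0r ?mulr0.
Qed.

Lemma star_pairing_sqr : starA N * starA N = 0.
Proof. by rewrite -(starM hsA) pairing_sqr (star0 hsA). Qed.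

Lemma pairing_sum : N * starA N + starA N * N = 1.
Proof.
apply/matrixP=> i j; rewrite !mxE.
have odd_m : odd m by rewrite -[odd m]negbK -oddS hm oddM.
have [oi|ei] := boolP (odd i).
  rewrite big1 ?add0r => [|k _]; last by rewrite !mxE oi mul0r.
  have pi : (i.-1 < m.+1)%N by rewrite (leq_ltn_trans (leq_pred i)).
  have i0 : (0 < i)%N by case: (i : nat) oi.
  rewrite (bigD1 (Ordinal pi)) //= big1 ?addr0 => [|k kp].
    rewrite star_pairingE !mxE /= prednK // eqxx andbT.
    have -> : odd i.-1 = false by apply/negbTE; rewrite -oddS prednK.
    by rewrite /= mul1r eq_sym.
  rewrite star_pairingE (_ : (_ == _ :> nat) = false) ?andbF ?mul0r //.
  apply: contraNF kp => /eqP ik; apply/eqP/val_inj; by rewrite /= ik.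
rewrite [X in _ + X]big1 ?addr0 => [|k _]; last first.
  rewrite star_pairingE; case: eqP => [ik|_]; last by rewrite andbF mul0r.
  by move: ei; rewrite ik /= negbK => ->; rewrite mul0r.
(* The size is even, so the last index is odd. *)
have pi : (i.+1 < m.+1)%N.
  rewrite ltn_neqAle ltn_ord andbT; apply: contraNneq ei => - [->].
  by [].
rewrite (bigD1 (Ordinal pi)) //= big1 ?addr0 => [|k kp].
  rewrite star_pairingE !mxE /= eqxx andbT ei mul1r eqSS.
  rewrite -[in RHS]val_eqE /=.
  by case: eqP => [<-|_]; [rewrite (negPf ei) | rewrite andbF].
rewrite !mxE (_ : (_ == _ :> nat) = false) ?andbF ?mul0r //.
by apply: contraNF kp => /eqP ik; apply/eqP/val_inj.
Qed.

Definition pairing_skew : A := N - starA N.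

Lemma star_skew : starA pairing_skew = - pairing_skew.
Proof. by rewrite (starB hsA) (starK hsA) opprB. Qed.

Lemma skew_sqr : pairing_skew * pairing_skew = - 1.
Proof.
rewrite mulrBl !mulrBr pairing_sqr star_pairing_sqr sub0r subr0.
by rewrite -pairing_sum opprD.
Qed.

Lemma pairing_mulK : N * starA N * N = N.
Proof.
have /(congr1 ( *%R N)) := pairing_sum.
by rewrite mulrDr !mulrA pairing_sqr mul0r add0r mulr1.
Qed.

Lemma pairing_skew_unit : pairing_skew \is a GRing.unit.
Proof.
by apply/unitrP; exists (- pairing_skew); rewrite mulNr mulrN skew_sqr opprK.
Qed.

Lemma pairing_skew_sym : @eps_sym A starA 1 pairing_skew.
Proof. by rewrite /eps_sym mul1r star_skew addrN. Qed.

(** The usual factorization of a Weyl element into unipotents; through it [mu], being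
    trivial on unipotents, is trivial on the skew matrix. *)
Lemma skew_factor : pairing_skew = (1 + N) * (1 - starA N) * (1 + N).
Proof.
rewrite mulrDl mul1r mulrBr mulr1 mulrDr mulr1 !mulrDl mul1r !mulNr pairing_sqr pairing_mulK.
have -> : starA N * N = 1 - N * starA N by rewrite -pairing_sum addrC addKr.
rewrite sub0r opprB (addrC N (_ - 1)) addrK addrA -(addrA (1 - _)) subrK.
by rewrite (addrC 1) -!addrA (addrCA 1) subrr addr0 addrC.
Qed.

End PairingMatrix.

Section Character.
Variables (F : fieldType) (B : finUnitRingType) (star : B -> B) (eps : int).
Hypothesis hs : is_involution star.
Hypothesis heps : eps = 1 \/ eps = -1.
Hypothesis h2 : (2%:R : B) \is a GRing.unit.
Variable beta : B -> F.
Hypothesis hb : linear_character beta.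
Hypothesis hprim : primitive_character beta.
Hypothesis hbe : forall b, beta (b + eps%:~R * star b) = 1.
Local Notation E := (eps%:~R : B).

Lemma betaD a b : beta (a + b) = beta a * beta b. Proof. by case: hb. Qed.
Lemma beta_neq0 a : beta a != 0. Proof. by case: hb. Qed.
Lemma beta0 : beta 0 = 1.
Proof. by apply: (mulfI (beta_neq0 0)); rewrite -betaD !addr0 mulr1. Qed.
Lemma betaN a : beta (- a) = (beta a)^-1.
Proof. by apply: (mulfI (beta_neq0 a)); rewrite -betaD addrN beta0 divff ?beta_neq0. Qed.
Lemma beta_sum (J : Type) (r : seq J) (p : pred J) (G : J -> B) :
  beta (\sum_(i <- r | p i) G i) = \prod_(i <- r | p i) beta (G i).
Proof. exact: (big_morph beta betaD beta0). Qed.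
Lemma beta_eps_star b : beta (E * star b) = beta (- b).
Proof. by apply: (mulfI (beta_neq0 b)); rewrite -!betaD hbe addrN beta0. Qed.
Lemma beta_star b : beta (star b) = beta (- (E * b)).
Proof.
rewrite -beta_eps_star; congr beta.
by rewrite (starM hs) (star_eps hs heps) -(epsC heps) (epsK heps).
Qed.

(** Primitivity concerns right ideals, but [beta (b^* ) = beta (- eps b)] lets one
    exchange the left ideal [B a] for the right ideal [a^* B]. *)
Lemma beta_nondeg a : (forall b, beta (2%:R * (b * a)) = 1) -> a = 0.
Proof.
move=> h; have hl b : beta (b * a) = 1.
  by rewrite -(h (2%:R^-1 * b)) mulrA mulrA mulrV // mul1r.
pose K := [set star a * b | b in [set: B]].
have hK : right_ideal K.
  apply/and3P; split.
  - by apply/imsetP; exists 0; rewrite ?inE ?mulr0.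
  - apply/forall_inP=> x /imsetP[b _ ->]; apply/forall_inP=> y /imsetP[c _ ->].
    by apply/imsetP; exists (b - c); rewrite ?inE ?mulrBr.
  - apply/forall_inP=> x /imsetP[b _ ->]; apply/forallP=> c.
    by apply/imsetP; exists (b * c); rewrite ?inE ?mulrA.
have sa : star a \in K by apply/imsetP; exists 1; rewrite ?inE ?mulr1.
have /setP/(_ (star a)) : K = [set 0].
  apply: hprim => // x /imsetP[b _ ->].
  by rewrite -[b](starK hs) -(starM hs) beta_star mulrA -mulNr hl.
by rewrite sa inE => /esym/eqP h0; rewrite -[a](starK hs) h0 (star0 hs).
Qed.

End Character.

(** * The Weil representation *)

Section WeilRepresentation.
Variables (R : realType) (eps : int) (heps : eps = 1 \/ eps = -1).
Variables (B : finUnitRingType) (h2 : (2%:R : B) \is a GRing.unit).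
Variables (star : B -> B) (hs : is_involution star).
Variables (beta : B -> R[i]) (hb : linear_character beta).
Hypothesis hprim : primitive_character beta.
Hypothesis hbe : forall b, beta (b + eps%:~R * star b) = 1.
Variable m : nat.
Local Notation A := (matring B m).
Local Notation P := (colspace B m).
Local Notation starA := (@star_trmx B star m).
Local Notation ds := (@dotstar B star m).
Local Notation chi := (@weil_chi B star m R beta).
Local Notation gamma := (@weil_gamma B star eps m R beta).
Local Notation sym := (@eps_sym A starA eps).
Local Notation EB := (eps%:~R : B).
Local Notation EA := (eps%:~R : A).
Local Notation SL := (@SLstar A starA eps).
Local Notation SSL := (@SSLstar A starA eps).
Implicit Types (x y z u v w : P) (t r : A).

Let hsA : is_involution starA := star_trmx_involution hs m.

Lemma chi_neq0 x y : chi x y != 0. Proof. exact: beta_neq0. Qed.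
Lemma chiDl x x' y : chi (x + x') y = chi x y * chi x' y.
Proof. by rewrite /weil_chi dotstarDl // mulrDr betaD. Qed.
Lemma chiDr x y y' : chi x (y + y') = chi x y * chi x y'.
Proof. by rewrite /weil_chi dotstarDr mulrDr betaD. Qed.
Lemma chiNl x y : chi (- x) y = (chi x y)^-1.
Proof. by rewrite /weil_chi dotstarNl // mulrN betaN. Qed.
Lemma chi0l y : chi 0 y = 1.
Proof. by rewrite /weil_chi dotstar0l // mulr0 (beta0 hb). Qed.
Lemma chi0r x : chi x 0 = 1.
Proof. by rewrite /weil_chi dotstar0r mulr0 (beta0 hb). Qed.
Lemma chiZ t x y : chi (t *: x) y = chi x (starA t *: y).
Proof. by rewrite /weil_chi dotstarZl. Qed.

Lemma chi_swap x y : chi y x = chi x y ^ (- eps).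
Proof.
rewrite /weil_chi -star_dotstar //.
have -> : 2%:R * star (ds x y) = star (2%:R * ds x y).
  by rewrite (starM hs) (star_nat hs) mulr_natl mulr_natr.
rewrite (beta_star hs heps hb hbe).
by case: heps => ->; rewrite ?mulrNz mulr1z ?mul1r ?mulN1r ?opprK // betaN.
Qed.

Lemma chi_nondeg y : (forall x, chi x y = 1) -> y = 0.
Proof.
move=> h; apply/matrixP=> i j; rewrite (ord1 j) mxE.
apply: (beta_nondeg hs heps h2 hb hprim hbe) => b.
by have := h (unit_col i (star b)); rewrite /weil_chi dotstar_unit_col // (starK hs).
Qed.

Lemma sum_chi y : \sum_x chi x y = if y == 0 then #|{: P}|%:R else 0.
Proof.
case: eqVneq => [->|y0].
  by rewrite (eq_bigr (fun=> 1)) => [|x _]; rewrite ?chi0r // sumr_const.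
have [x hx] : exists x, chi x y != 1.
  apply/existsP; rewrite -negb_forall; apply: contraNN y0 => /forallP h.
  by apply/eqP/chi_nondeg => x; apply/eqP.
apply: (mulfI (_ : chi x y - 1 != 0)); first by rewrite subr_eq0.
rewrite mulr0 mulrBl mul1r mulr_sumr [X in _ - X](reindex_inj (addrI x)) /=.
by apply/eqP; rewrite subr_eq0; apply/eqP/eq_bigr => z _; rewrite chiDl.
Qed.

Lemma gamma_neq0 r x : gamma r x != 0. Proof. exact: beta_neq0. Qed.
Lemma gammaD r r' x : gamma (r + r') x = gamma r x * gamma r' x.
Proof. by rewrite /weil_gamma scalerDl dotstarDr mulrDr opprD betaD. Qed.
Lemma gammaZ r t x : gamma r (t *: x) = gamma (starA t * r * t) x.
Proof. by rewrite /weil_gamma dotstarZl // !scalerA. Qed.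
Lemma gamma0 r : gamma r 0 = 1.
Proof. by rewrite /weil_gamma scaler0 dotstar0r mulr0 oppr0 (beta0 hb). Qed.
Lemma gammaN r x : gamma r (- x) = gamma r x.
Proof. by rewrite /weil_gamma scalerN dotstarNr dotstarNl // opprK. Qed.

Lemma sym_dotstar r x y : sym r -> ds (r *: x) y = - (EB * ds x (r *: y)).
Proof.
move=> /(eps_symP _ heps) hr; rewrite dotstarZl // hr.
case: heps => ->; rewrite ?mulrNz !mulr1z ?mulN1r ?mul1r ?opprK //.
by rewrite scaleNr dotstarNr.
Qed.

Lemma gamma_add r x z : sym r -> gamma r (x + z) = gamma r x * gamma r z * chi (r *: z) x.
Proof.
move=> hr; have hx : beta (- (EB * ds x (r *: z))) = beta (- (EB * ds z (r *: x))).
  have -> : ds x (r *: z) = star (ds (r *: z) x) by rewrite star_dotstar.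
  by rewrite -mulrN -(starN hs) beta_eps_star // (sym_dotstar z x hr) !opprK.
rewrite /weil_gamma /weil_chi (sym_dotstar z x hr) scalerDr (dotstarDl hs) !dotstarDr.
rewrite !mulrDr !opprD !(betaD hb) hx mulrN mulr_natl mulr2n opprD (betaD hb).
by ring.
Qed.

Variables (X : vectType R[i]) (e : P -> X).
Hypothesis he : basis_of fullv (codom e).
Local Notation hf := (@hform B star eps m).

(** [(b, (u, w))] factors as a central element times [(0, (u, 0)) (0, (0, w))]; the
    exponent collects the resulting central terms. *)
Definition schrodinger (k : B * (P * P)) : 'End(X) :=
  basis_map e (fun v =>
    beta (k.1 + ds k.2.1 k.2.2 + 2%:R * ds k.2.1 v) *: e (v + k.2.2)).

Lemma schrodingerE b u w v :
  schrodinger (b, (u, w)) (e v) = beta (b + ds u w + 2%:R * ds u v) *: e (v + w).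
Proof. by rewrite basis_mapE. Qed.

Lemma beta_eps_swap x y : beta (EB * ds x y) = beta (- ds y x).
Proof. by rewrite -(star_dotstar hs) beta_eps_star. Qed.

Lemma schrodingerM k l :
  schrodinger (heis_mul star eps k l) = (schrodinger k \o schrodinger l)%VF.
Proof.
apply: (basis_eq he) => v; case: k l => [b [u w]] [c [u' w']].
rewrite /heis_mul /hform /= comp_lfunE !schrodingerE linearZ /= schrodingerE scalerA.
rewrite -(addrA v) (addrC w' w); congr (_ *: _).
rewrite !(dotstarDl hs) !dotstarDr !mulrDr !(betaD hb) beta_eps_swap.
by rewrite !mulr_natl !mulr2n !(betaD hb) (betaN hb); field; rewrite (beta_neq0 hb).
Qed.

Lemma schrodingerP : is_schrodinger star eps beta e schrodinger.
Proof.
split=> [|k l|b v|w v|u v].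
- apply: (basis_eq he) => v.
  by rewrite schrodingerE id_lfunE !(dotstar0l hs) mulr0 !addr0 (beta0 hb) scale1r.
- exact: schrodingerM.
- by rewrite schrodingerE !(dotstar0l hs) mulr0 !addr0.
- by rewrite schrodingerE !(dotstar0l hs) mulr0 !addr0 (beta0 hb) scale1r.
- by rewrite schrodingerE /hform /= dotstar0r (dotstar0l hs) mulr0 !addr0 add0r.
Qed.

Lemma schrodinger_unique S : is_schrodinger star eps beta e S -> S =1 schrodinger.
Proof.
move=> hS k; case: hS (schrodingerP) => [S1 SM Sb Sw Su] [T1 TM Tb Tw Tu].
case: k => b [u w].
have -> : (b, (u, w)) = heis_mul star eps
    (heis_mul star eps (b - ds u w, (0, 0)) (0, (u, 0))) (0, (0, w)).
  rewrite /heis_mul /hform /= !(dotstar0l hs) mulr0 !addr0 !add0r.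
  by rewrite (dotstar0l hs) mulr0 addr0 subrK -[(u, 0) + _]/(u + 0, 0 + w) addr0 add0r.
rewrite !SM !TM; congr (_ \o _ \o _)%VF; apply: (basis_eq he) => v.
- by rewrite Sb Tb.
- by rewrite Su Tu.
- by rewrite Sw Tw.
Qed.

Lemma intertwinerP (g : {unit matring A 1}) (T : 'End(X)) :
  intertwiner star eps beta e g T <->
  lker T = 0%VS /\
  forall k v, T (schrodinger k (e v)) = schrodinger (heis_act g k) (T (e v)).
Proof.
split=> [[kT [S hS hT]]|[kT hT]].
  split=> // k v; rewrite -!(schrodinger_unique hS) -hT !comp_lfunE.
  by rewrite lker0_lfunK // kT.
split=> //; exists schrodinger; first exact: schrodingerP.
move=> k; have -> : (T \o schrodinger k)%VF = (schrodinger (heis_act g k) \o T)%VF.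
  by apply: (basis_eq he) => v; rewrite !comp_lfunE hT.
by rewrite -comp_lfunA lker0_compfV ?kT // comp_lfun1r.
Qed.

Lemma bcoord_schrodinger u y (z : X) :
  bcoord e y (schrodinger (0, (u, 0)) z) = chi u y * bcoord e y z.
Proof.
rewrite (bcoord_sum he z) !linear_sum mulr_sumr; apply: eq_bigr => x _.
rewrite !linearZ /= schrodingerE !linearZ dotstar0r addr0 !add0r /= addr0 !(bcoord_basis he).
by case: eqVneq => [->|_]; rewrite ?mulr0 // !mulr1 mulrC.
Qed.

(** Schur's lemma for the Schrodinger representation: [M] fixes [e 0], and by
    nondegeneracy fixes no vector outside the line of [e 0], so [Q] preserves
    that line; the translations by [N] carry the eigenvalue to every [e v]. *)
Lemma schrodinger_irreducible (Q : 'End(X)) :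
  (forall k v, Q (schrodinger k (e v)) = schrodinger k (Q (e v))) ->
  exists a, Q = a *: \1%VF.
Proof.
move=> hQ; exists (bcoord e 0 (Q (e 0))); apply: (basis_eq he) => v.
have hu (u : P) : schrodinger (0, (u, 0)) (e 0) = e 0.
  by rewrite schrodingerE !dotstar0r mulr0 !addr0 (beta0 hb) scale1r.
have diag : Q (e 0) = bcoord e 0 (Q (e 0)) *: e 0.
  apply: (bcoord_eq he) => y; rewrite linearZ /= (bcoord_basis he).
  case: eqVneq => [->|y0]; first by rewrite mulr1.
  rewrite mulr0; apply/eqP; apply: contraNT y0 => cy.
  apply/eqP/chi_nondeg => u; apply: (mulIf cy).
  by rewrite -bcoord_schrodinger -hQ hu mul1r.
have ev : schrodinger (0, (0, v)) (e 0) = e v.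
  by rewrite schrodingerE !(dotstar0l hs) mulr0 !addr0 (beta0 hb) scale1r add0r.
by rewrite -ev hQ diag linearZ /= ev scale_lfunE id_lfunE -diag.
Qed.

Implicit Types (g k : {unit matring A 1}) (T : 'End(X)).

Lemma act22M g k p : act22 (g * k)%g p = act22 g (act22 k p).
Proof.
by case: p => x y; rewrite /act22 !ent_mul /= !scalerDr !scalerDl !scalerA; congr (_, _);
   rewrite -!addrA; congr (_ + _); rewrite addrCA.
Qed.

Lemma heis_actM g k p : heis_act (g * k)%g p = heis_act g (heis_act k p).
Proof. by rewrite /heis_act act22M. Qed.

Lemma heis_act1 p : heis_act (1%g : {unit matring A 1}) p = p.
Proof.
case: p => b [x y]; rewrite /heis_act /act22 /=.
have h : val (1%g : {unit matring A 1}) = mx22 1 0 0 1 := esym (mx22_1 A).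
have [-> -> -> ->] := ent_mx22 h.
by rewrite !scale1r !scale0r addr0 add0r.
Qed.

(** Commutation with parity is part of the notion because multiplicativity of
    [det_ratio] requires stable eigenspaces. The explicit operators for the
    Bruhat elements have it, hence so do their products. *)
Definition weil_operator g T :=
  intertwiner star eps beta e g T /\ commutes_parity e T.

Lemma weil_operator1 : weil_operator 1%g \1%VF.
Proof.
split; last by move=> x; rewrite !id_lfunE.
apply/intertwinerP; split=> [|k v]; last by rewrite !id_lfunE heis_act1.
by apply: (basis_lker0 he (T' := \1%VF)) => v; rewrite !id_lfunE.
Qed.

Lemma schrodinger_lin (k : B * (P * P)) T T' : (forall v, T (schrodinger k (e v)) = T' (T (e v))) ->
  forall x : X, T (schrodinger k x) = T' (T x).
Proof.
move=> h x; suff : (T \o schrodinger k)%VF = (T' \o T)%VF.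
  by move/lfunP/(_ x); rewrite !comp_lfunE.
by apply: (basis_eq he) => v; rewrite !comp_lfunE h.
Qed.

Lemma weil_operatorM g k T T' : weil_operator g T -> weil_operator k T' ->
  weil_operator (g * k)%g (T \o T')%VF.
Proof.
move=> [/intertwinerP[kT hT] pT] [/intertwinerP[kT' hT'] pT'].
split; last by move=> x; rewrite !comp_lfunE pT' pT.
apply/intertwinerP; split=> [|l v].
  have /eqP/lker0P iT := kT; have /eqP/lker0P iT' := kT'.
  by apply/eqP/lker0P => x y; rewrite !comp_lfunE => /iT/iT'.
rewrite !comp_lfunE hT' (schrodinger_lin (T' := schrodinger (heis_act g (heis_act k l)))) //.
by rewrite heis_actM.
Qed.

Lemma intertwiner_proportional g T T' :
  intertwiner star eps beta e g T -> intertwiner star eps beta e g T' ->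
  exists2 a, a != 0 & T' = a *: T.
Proof.
move=> /intertwinerP[kT hT] /intertwinerP[kT' hT'].
have kT0 : lker T == 0%VS by rewrite kT.
have /lker0P iT := kT0; have TV (x : X) : T (T^-1%VF x) = x by rewrite lker0_lfunVK.
have [k v|a ha] := schrodinger_irreducible (Q := (T^-1 \o T')%VF).
  rewrite !comp_lfunE hT'; apply: iT.
  by rewrite TV (schrodinger_lin (T' := schrodinger (heis_act g k))) // TV.
have eT : T' = a *: T.
  apply: (basis_eq he) => v; rewrite scale_lfunE -[LHS]TV -(comp_lfunE T^-1%VF T') ha.
  by rewrite scale_lfunE id_lfunE linearZ.
exists a => //; apply: contra_eq_neq kT' => a0.
rewrite eT a0 scale0r; apply/negP=> /lker0P/(_ (e 0) 0).
rewrite !zero_lfunE => /(_ erefl) e00.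
by have /eqP := bcoord_basis he 0 0; rewrite e00 linear0 eqxx eq_sym oner_eq0.
Qed.

Variables (I : {set P}) (hI : half_system I).

Lemma half_system0 : 0 \notin I. Proof. by case: hI. Qed.

Lemma half_systemN v : v != 0 -> (- v \in I) = (v \notin I).
Proof.
move=> v0; have := hI.2 v v0.
have vN : v != - v.
  apply: contraNneq v0 => vE; apply/eqP/matrixP => i j; rewrite (ord1 j) mxE.
  apply: (mulrI h2); rewrite mulr0 mulr_natl mulr2n {2}vE !mxE.
  by rewrite addrN.
have [vI|vI] := boolP (v \in I); have [NvI|NvI] := boolP (- v \in I) => //.
  by rewrite (finset.setIidPr _) ?cards2 ?vN //; apply/fintype.subsetP=> x /set2P[]->.
rewrite (_ : I :&: _ = finset.set0) ?cards0 //; apply/setP=> x; rewrite !inE.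
by apply/negP=> /andP[xI /orP[]/eqP xE]; move: xI; rewrite xE ?(negPf vI) ?(negPf NvI).
Qed.

Lemma two_neq0 : 2%:R != 0 :> R[i]. Proof. by rewrite pnatr_eq0. Qed.

Lemma heisenberg_weilE g T : intertwiner star eps beta e g T ->
  heisenberg_weil star eps beta e g = det_ratio e T *: T.
Proof.
move=> hT; rewrite /heisenberg_weil.
have hx := xgetI (0 : 'End(X)) hT; case: (intertwiner_proportional hT hx) => a a0 ->.
rewrite (det_ratioZ he two_neq0 half_system0 half_systemN) // scalerA.
by rewrite mulrAC mulVf // mul1r.
Qed.

Lemma weil_lker0 g T : weil_operator g T -> lker T = 0%VS.
Proof. by case=> /intertwinerP[]. Qed.

Lemma weil_det_neq0 g T : weil_operator g T -> det_ratio e T != 0.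
Proof. by move=> hT; rewrite det_ratio_neq0 // ?(weil_lker0 hT) //; case: hT. Qed.

Definition h_operator t : 'End(X) := basis_map e (fun v => e (t *: v)).
Definition u_operator r : 'End(X) := basis_map e (fun v => gamma r v *: e v).
Definition fourier : 'End(X) := basis_map e (fun v => \sum_y chi v y *: e y).

Lemma h_operatorE t v : h_operator t (e v) = e (t *: v).
Proof. by rewrite basis_mapE. Qed.
Lemma u_operatorE r v : u_operator r (e v) = gamma r v *: e v.
Proof. by rewrite basis_mapE. Qed.
Lemma fourierE v : fourier (e v) = \sum_y chi v y *: e y.
Proof. by rewrite basis_mapE. Qed.

Lemma colspace_scale_inj t : t \is a GRing.unit -> injective (fun v => t *: v).
Proof.
move=> ut; apply: (can_inj (g := fun v => t^-1 *: v)) => v.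
by rewrite scalerA mulVr // scale1r.
Qed.

(** The counting definition of [mu] is a ratio of determinants; multiplicativity
    and independence of the half-system follow. *)
Lemma muE t : t \is a GRing.unit -> mu R I t = det_ratio e (h_operator t).
Proof.
move=> ut; rewrite (det_ratio_monomial he two_neq0 half_system0 half_systemN
  (c := fun=> 1) (Y := fun v => t *: v)) //.
- congr (_ ^+ _); apply: eq_card => v; rewrite !inE; apply: andb_id2l => vI.
  have v0 : v != 0 by apply: contraTneq vI => ->; exact: half_system0.
  have tv0 : t *: v != 0.
    by apply: contraNneq v0 => tv; rewrite -[v]scale1r -(mulVr ut) -scalerA tv scaler0.
  rewrite -half_systemN //; apply/imsetP/idP => [[w wI ->]|h]; first by rewrite opprK.
  by exists (- (t *: v)); rewrite ?opprK.
- by move=> v; rewrite basis_mapE // scale1r.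
- by move=> v; rewrite scalerN.
- by move=> v; apply: contraNneq => tv; rewrite -[v]scale1r -(mulVr ut) -scalerA tv scaler0.
- exact: scaler0.
apply: (basis_lker0 he (T' := h_operator t^-1)) => v.
by rewrite !basis_mapE // scalerA mulVr // scale1r.
Qed.

Lemma h_operator_parity t : commutes_parity e (h_operator t).
Proof.
apply: (commutes_parity_basis he) => v.
by rewrite !basis_mapE // scalerN.
Qed.

Lemma h_operatorM s t : h_operator (s * t) = (h_operator s \o h_operator t)%VF.
Proof. by apply: (basis_eq he) => v; rewrite comp_lfunE !basis_mapE // scalerA. Qed.

Lemma muM s t : s \is a GRing.unit -> t \is a GRing.unit ->
  mu R I (s * t) = mu R I s * mu R I t.
Proof.
move=> us ut; have ust : s * t \is a GRing.unit by rewrite unitrMl.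
by rewrite (muE us) (muE ut) (muE ust) h_operatorM det_ratioM //; exact: h_operator_parity.
Qed.

Lemma mu_neq0 t : mu R I t != 0. Proof. by rewrite signr_eq0. Qed.
Lemma mu_sqr t : mu R I t * mu R I t = 1.
Proof. by rewrite -expr2 sqrr_sign. Qed.
Lemma mu1 : mu R I (1 : A) = 1.
Proof. by rewrite -[X in mu R I X]mulr1 muM ?unitr1 // mu_sqr. Qed.
Lemma muV t : t \is a GRing.unit -> mu R I t^-1 = mu R I t.
Proof.
by move=> ut; apply: (mulfI (mu_neq0 t)); rewrite -muM ?unitrV // mulrV // mu_sqr mu1.
Qed.

Lemma dotstar_eps x y : ds x (EA *: y) = EB * ds x y.
Proof.
by case: heps => ->; rewrite ?mulrNz !mulr1z ?scaleNr scale1r ?dotstarNr ?mulN1r ?mul1r.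
Qed.

Lemma chiNr x y : chi x (- y) = (chi x y)^-1.
Proof. by rewrite /weil_chi dotstarNr mulrN betaN. Qed.

Lemma chi_swapE x y : chi x y = chi y (- (EA *: x)).
Proof.
rewrite chiNr (chi_swap y x) /weil_chi dotstar_eps.
by case: heps => ->; rewrite ?mulrNz !mulr1z ?opprK ?mul1r // mulN1r mulrN betaN // invrK.
Qed.

Lemma fourier_sqr x : fourier (fourier (e x)) = #|{: P}|%:R *: e (EA *: x).
Proof.
rewrite basis_mapE // linear_sum.
transitivity (\sum_z (\sum_y chi y (z - EA *: x)) *: e z).
  rewrite (eq_bigr (fun y => \sum_z chi y (z - EA *: x) *: e z)) => [|y _].
    by rewrite exchange_big; apply: eq_bigr => z _; rewrite scaler_suml.
  rewrite linearZ /= basis_mapE // scaler_sumr; apply: eq_bigr => z _.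
  by rewrite scalerA chiDr -chi_swapE mulrC.
rewrite (bigD1 (EA *: x)) //= [X in _ + X]big1 ?addr0 => [|z zx]; first by rewrite sum_chi subrr eqxx.
by rewrite sum_chi subr_eq0 (negPf zx) scale0r.
Qed.

Lemma card_neq0 : #|{: P}|%:R != 0 :> R[i].
Proof. by rewrite pnatr_eq0 -lt0n; apply/card_gt0P; exists 0. Qed.

Lemma h_weil t : t \is a GRing.unit ->
  weil_operator (bruhat_h starA t) (h_operator (starA t)^-1).
Proof.
move=> ut; have ust : starA t \is a GRing.unit := star_unit hsA ut.
split; last exact: h_operator_parity.
apply/intertwinerP; split=> [|[b [u w]] v].
  apply: (basis_lker0 he (T' := h_operator (starA t))) => v.
  by rewrite !h_operatorE scalerA mulrV // scale1r.
rewrite /heis_act /act22; have [-> -> -> ->] := ent_mx22 (bruhat_hE hsA ut) => /=.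
rewrite !scale0r addr0 add0r schrodingerE linearZ /= !h_operatorE scalerDr schrodingerE.
by rewrite !dotstarZl // !scalerA mulrV // !scale1r.
Qed.

Lemma u_weil r : sym r -> weil_operator (bruhat_u r) (u_operator r).
Proof.
move=> hr; split; last first.
  by apply: (commutes_parity_basis he) => v; rewrite !u_operatorE gammaN linearZ /= parityE // (basis_free he).
apply/intertwinerP; split=> [|[b [u w]] v].
  apply: (basis_lker0 he (T' := basis_map e (fun v => (gamma r v)^-1 *: e v))) => v.
  by rewrite u_operatorE linearZ /= basis_mapE // scalerA divff ?gamma_neq0 // scale1r.
rewrite /heis_act /act22; have [-> -> -> ->] := ent_mx22 (bruhat_uE r) => /=.
rewrite !scale0r !scale1r add0r schrodingerE linearZ /= !u_operatorE [in RHS]linearZ /=.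
rewrite schrodingerE !scalerA gamma_add //; congr (_ *: _).
have -> : gamma r w = beta (ds (r *: w) w) by rewrite sym_dotstar.
rewrite /weil_chi !(dotstarDl hs) !mulrDr !(betaD hb).
by ring.
Qed.

Lemma omega_weil : weil_operator (bruhat_omega A eps) fourier.
Proof.
split.
  apply/intertwinerP; split=> [|[b [u w]] v].
    apply: (basis_lker0 he (T' := #|{: P}|%:R^-1 *: (h_operator EA \o fourier)%VF)) => v.
    rewrite scale_lfunE comp_lfunE fourier_sqr linearZ /= h_operatorE !scalerA.
    by rewrite mulVf ?card_neq0 // (epsM A heps) !scale1r.
  rewrite /heis_act /act22; have [-> -> -> ->] := ent_mx22 (bruhat_omegaE A heps) => /=.
  rewrite !scale0r !scale1r addr0 add0r schrodingerE linearZ /= !fourierE scaler_sumr [RHS]linear_sum.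
  rewrite [RHS](reindex_inj (addIr (- (EA *: u)))) /=; apply: eq_bigr => z _.
  rewrite [in RHS]linearZ /= schrodingerE subrK !scalerA; congr (_ *: _).
  rewrite chiDl chiDr -chi_swapE dotstarDr mulrDr !(betaD hb).
  rewrite dotstar_eps beta_eps_swap.
  rewrite -[beta (2%:R * ds w (- _))]/(chi w (- (EA *: u))) -chi_swapE /weil_chi.
  rewrite (mulr_natl (ds u w)) mulr2n (betaD hb (ds u w)) (betaN hb).
  by field; rewrite (beta_neq0 hb).
apply: (commutes_parity_basis he) => v; rewrite !fourierE linear_sum.
rewrite (reindex_inj oppr_inj); apply: eq_bigr => z _.
by rewrite linearZ /= parityE ?(basis_free he) // chiNl chiNr invrK.
Qed.

Local Notation c0 := (det_ratio e fourier).
Local Notation W := (heisenberg_weil star eps beta e).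

(** All of [SSL] is reached by products of three explicit families of operators,
    without a general existence theorem for the intertwiners. *)
Lemma weil_exists g : g \in SSL -> exists T, weil_operator g T.
Proof.
pose G := [set g | `[< exists T, weil_operator g T >]].
have hG k : (k \in G) = `[< exists T, weil_operator k T >] by rewrite inE.
have gG : group_set G.
  apply/group_setP; split; first by rewrite hG; apply/asboolP; exists \1%VF; exact: weil_operator1.
  move=> x y; rewrite !hG => /asboolP[T hT] /asboolP[T' hT']; apply/asboolP.
  by exists (T \o T')%VF; apply: weil_operatorM.
have sG : SSL \subset Group gG.
  apply: SSL_sub_group => [|t ut|r hr]; rewrite hG; apply/asboolP.
  - by exists fourier; exact: omega_weil.
  - by exists (h_operator (starA t)^-1); exact: h_weil.
  - by exists (u_operator r); exact: u_weil.
by move=> /(fintype.subsetP sG); rewrite hG => /asboolP.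
Qed.

Lemma weilE g T : weil_operator g T -> W g = det_ratio e T *: T.
Proof. by case=> hT _; exact: heisenberg_weilE. Qed.

Lemma det_u_operator r : sym r -> det_ratio e (u_operator r) = 1.
Proof.
move=> hr; rewrite (det_ratio_monomial he two_neq0 half_system0 half_systemN
  (c := gamma r) (Y := id)) //.
- rewrite (_ : [set _ in _ | _] = finset.set0) ?cards0 //.
  by apply/setP=> v; rewrite !inE; case: (v \in I).
- exact: u_operatorE.
- exact: gammaN.
- exact: gamma0.
- exact: weil_lker0 (u_weil hr).
Qed.

(** The Fourier transform intertwines [t] with the inverse of [t^*], so both have
    the same ratio of determinants. *)
Lemma mu_star t : t \is a GRing.unit -> mu R I (starA t) = mu R I t.
Proof.
move=> ut; have ust : starA t \is a GRing.unit := star_unit hsA ut.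
have uV : (starA t)^-1 \is a GRing.unit by rewrite unitrV.
rewrite -(muV ust) (muE uV) (muE ut); apply: (mulfI (weil_det_neq0 omega_weil)).
have [_ pf] := omega_weil.
have e1 := det_ratioM (h_operator (starA t)^-1) pf.
have e2 := det_ratioM fourier (h_operator_parity t).
apply: (etrans (mulrC _ _)); apply: (etrans (esym e1)); apply: (etrans _ e2).
congr det_ratio; apply: (basis_eq he) => x.
rewrite !comp_lfunE h_operatorE !fourierE linear_sum.
rewrite [RHS](reindex_inj (colspace_scale_inj uV)).
apply: eq_bigr => y _; rewrite linearZ /= h_operatorE chiZ.
by rewrite scalerA mulrV // scale1r.
Qed.

Lemma det_h_operator t : t \is a GRing.unit ->
  det_ratio e (h_operator (starA t)^-1) = mu R I t.
Proof.
move=> ut; have ust : starA t \is a GRing.unit := star_unit hsA ut.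
by rewrite -muE ?unitrV // muV // mu_star.
Qed.

Lemma weil_representation : representation_on SSL W.
Proof.
split=> [|g k /weil_exists[T hT] /weil_exists[T' hT']].
  by rewrite (weilE weil_operator1) det_ratio1 scale1r.
rewrite (weilE hT) (weilE hT') (weilE (weil_operatorM hT hT')) det_ratioM //; last by case: hT'.
by rewrite -comp_lfunZl -comp_lfunZr scalerA.
Qed.

Lemma weil_formulas :
  bruhat_formulas star eps e (mu R I) gamma chi c0 W.
Proof.
split=> [t x ut|r x hr|x].
- by rewrite (weilE (h_weil ut)) scale_lfunE h_operatorE det_h_operator.
- by rewrite (weilE (u_weil hr)) scale_lfunE u_operatorE det_u_operator // scale1r.
- by rewrite (weilE omega_weil) scale_lfunE fourierE.
Qed.

Lemma fourier_det_sqr : c0 ^+ 2 * #|{: P}|%:R = mu R I EA.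
Proof.
have uE : EA \is a GRing.unit := eps_unit A heps.
have := weilE (h_weil uE); rewrite -(omega_sqr hsA heps).
rewrite (weilE (weil_operatorM omega_weil omega_weil)) det_h_operator //.
move=> /(congr1 (fun T => bcoord e 0 (T (e 0)))).
rewrite !scale_lfunE comp_lfunE fourier_sqr h_operatorE !scaler0 !linearZ /=.
rewrite (bcoord_basis he) eqxx !mulr1 det_ratioM //; last by case: omega_weil.
Qed.

Lemma bcoord_u_operator r y (z : X) :
  bcoord e y (u_operator r z) = gamma r y * bcoord e y z.
Proof.
rewrite (bcoord_sum he z) !linear_sum mulr_sumr; apply: eq_bigr => x _.
rewrite !linearZ /= u_operatorE linearZ /= (bcoord_basis he).
by case: eqVneq => [->|_]; rewrite ?mulr0 // !mulr1 mulrC.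
Qed.

Lemma bcoord0_h_operator t (z : X) : t \is a GRing.unit ->
  bcoord e 0 (h_operator t z) = bcoord e 0 z.
Proof.
move=> ut; rewrite (bcoord_sum he z) !linear_sum; apply: eq_bigr => x _.
rewrite !linearZ /= h_operatorE !(bcoord_basis he) eq_sym -{1}[0](scaler0 _ t).
by rewrite (inj_eq (colspace_scale_inj ut)) eq_sym.
Qed.

Lemma bcoord0_fourier (z : X) : bcoord e 0 (fourier z) = \sum_y bcoord e y z.
Proof.
rewrite {1}(bcoord_sum he z) !linear_sum; apply: eq_bigr => x _.
rewrite !linearZ /= fourierE linear_sum (bigD1 0) //= big1 => [|y y0].
  by rewrite linearZ /= (bcoord_basis he) eqxx chi0r addr0 !mulr1.
by rewrite linearZ /= (bcoord_basis he) eq_sym (negPf y0) mulr0.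
Qed.

Lemma bcoord_fourier x y : bcoord e y (fourier (e x)) = chi x y.
Proof.
rewrite fourierE linear_sum (bigD1 y) //= big1 => [|z zy].
  by rewrite linearZ /= (bcoord_basis he) eqxx addr0 mulr1.
by rewrite linearZ /= (bcoord_basis he) eq_sym (negPf zy) mulr0.
Qed.

(** Both sides of the Bruhat relation, applied to [e x] and read at [e 0]: the left
    side contains [fourier] twice and the right side once, which leaves one
    factor [c0] in front of the Gauss sum. *)
Lemma fourier_det_gauss t x : sym t -> t \is a GRing.unit ->
  c0 * gamma (- (EA * t)) x * \sum_y chi x y * gamma t^-1 y = mu R I (- t).
Proof.
move=> ht ut; have hr := bruhat_relation hsA heps ht ut.
have uNt : - t \is a GRing.unit by rewrite unitrN.
have uY : (starA (- t))^-1 \is a GRing.unit by rewrite unitrV star_unit.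
have s1 := eps_symV hsA heps ht ut; have s2 := eps_symE hsA heps ht.
have s3 := eps_symN hsA heps s2.
have [_ WM] := weil_representation.
have GM g k : g \in SSL -> k \in SSL -> (g * k)%g \in SSL by apply: groupM.
have W3 a b c Ta Tb Tc : a \in SSL -> b \in SSL -> c \in SSL ->
    W a = Ta -> W b = Tb -> W c = Tc -> W (a * b * c)%g = (Ta \o Tb \o Tc)%VF.
  by move=> ha hb' hc <- <- <-; rewrite (WM _ _ (GM _ _ ha hb') hc) (WM _ _ ha hb').
have W4 a b c d Ta Tb Tc Td :
    a \in SSL -> b \in SSL -> c \in SSL -> d \in SSL ->
    W a = Ta -> W b = Tb -> W c = Tc -> W d = Td ->
    W (a * b * c * d)%g = (Ta \o Tb \o Tc \o Td)%VF.
  move=> ha hb' hc hd ea eb ec <-; rewrite (WM _ _ (GM _ _ (GM _ _ ha hb') hc) hd).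
  by rewrite (W3 _ _ _ _ _ _ ha hb' hc ea eb ec).
have mo := omega_SSL starA eps; have eo := weilE omega_weil.
have eL := W4 _ _ _ _ _ _ _ _ mo (u_SSL s1) mo (u_SSL s3) eo (weilE (u_weil s1)) eo (weilE (u_weil s3)).
have eR := W3 _ _ _ _ _ _ (u_SSL s2) (h_SSL starA eps uNt) mo (weilE (u_weil s2)) (weilE (h_weil uNt)) eo.
have {eL eR hr eo} := etrans (esym eL) (etrans (congr1 W hr) eR).
rewrite (det_u_operator s1) (det_u_operator s2) (det_u_operator s3) (det_h_operator uNt) !scale1r.
move=> /(congr1 (fun T => bcoord e 0 (T (e x)))).
have bZ v a (z : X) : bcoord e v (a *: z) = a * bcoord e v z by rewrite linearZ.
rewrite !comp_lfunE u_operatorE; move: (weil_det_neq0 omega_weil).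
move: (det_ratio e fourier) => c hc.
rewrite bcoord_u_operator gamma0 mul1r !scale_lfunE !bZ bcoord0_h_operator // bZ.
rewrite bcoord_fourier chi0r mulr1 bcoord0_fourier [RHS]mulrC => /(mulfI hc) <-.
rewrite mulr_sumr; apply: eq_bigr => y _.
by rewrite bcoord_u_operator bZ linearZ bZ bcoord_fourier /=; ring.
Qed.

Lemma card_colspace : #|{: P}| = (#|B| ^ m.+1)%N.
Proof. by rewrite (card_mx B m.+1 1) muln1. Qed.

Lemma sum_prod_col (F : B -> R[i]) :
  \sum_y \prod_i F ((y : 'cV_m.+1) i 0) = (\sum_b F b) ^+ m.+1.
Proof.
rewrite -[in RHS](card_ord m.+1) -prodr_const bigA_distr_bigA /=.
rewrite (reindex (fun y : {ffun 'I_m.+1 -> B} => (\col_i y i : P))) /=.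
  by apply: eq_bigr => y _; apply: eq_bigr => i _; rewrite mxE.
exists (fun y : P => [ffun i => (y : 'cV_m.+1) i 0]) => y _.
  by apply/ffunP => i; rewrite ffunE mxE.
by apply/matrixP => i j; rewrite !mxE ffunE (ord1 j).
Qed.

Lemma card_half : (#|I| = (#|B| ^ m.+1 - 1) %/ 2)%N.
Proof.
have /eqP : (#|{: P}| = 1 + #|I| * 2)%N.
  have := sum_half half_system0 half_systemN (fun _ : P => 1 : int).
  rewrite !sumr_const => h; apply/eqP; rewrite -(eqr_nat int) natrD natrM; apply/eqP.
  by apply: (etrans h); rewrite mulr_natl.
by rewrite card_colspace => /eqP ->; rewrite addKn mulnK.
Qed.

Lemma mu_opp1 : mu R I (- 1 : A) = (-1) ^+ ((#|B| ^ m.+1 - 1) %/ 2)%N.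
Proof.
rewrite -card_half; congr (_ ^+ _); apply: eq_card => v; rewrite !inE scaleN1r.
by case vI: (v \in I) => //=; apply/imsetP; exists v.
Qed.

Lemma sym1 : eps = -1 -> sym 1.
Proof. by move=> h; rewrite /eps_sym h (star1 hsA) mulr1 addrN. Qed.

Lemma gauss_det : eps = -1 ->
  c0 * gauss_sum star beta ^+ m.+1 = (-1) ^+ ((#|B| ^ m.+1 - 1) %/ 2)%N.
Proof.
move=> h; rewrite -mu_opp1 -(fourier_det_gauss 0 (sym1 h) (unitr1 _)) gamma0 mulr1.
congr (_ * _); rewrite /gauss_sum -sum_prod_col; apply: eq_bigr => y _.
rewrite chi0l mul1r invr1 /weil_gamma scale1r h mulN1r opprK.
by rewrite (beta_sum hb).
Qed.

(** Unipotent matrices are squares since [2] is invertible. *)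
Lemma mu_unipotent (a : A) : a * a = 0 -> mu R I (1 + a) = 1.
Proof.
move=> aa.
have u2 : (2%:R : A) \is a GRing.unit := matring_unit2 m h2.
pose h : A := 2%:R^-1.
have /esym ha : a * h = h * a := commrV (commr_nat a 2).
have hh : (h * a) * (h * a) = 0 by rewrite {2}ha mulrA -(mulrA h) aa mulr0 mul0r.
rewrite -(mu_sqr (1 + h * a)) -muM ?unipotent_unit //; congr (mu _ _ _).
rewrite mulrDl mul1r mulrDr mulr1 hh addr0 -addrA -mulrDl -mulr2n -mulr_natl.
by rewrite mulrV // mul1r.
Qed.

Variable n : nat.
Hypothesis hm : eps = 1 -> m.+1 = (2 * n)%N.

Section SplitCase.
Hypothesis e1 : eps = 1.
Local Notation N := (pairing B m).
Local Notation s := (pairing_skew star m).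
Let hN : m.+1 = (2 * n)%N := hm e1.

Lemma skew_sym : sym s.
Proof. by rewrite e1; exact: pairing_skew_sym. Qed.

Lemma mu_skew : mu R I s = 1.
Proof.
have NN := pairing_sqr B m.
have NN' : - starA N * - starA N = 0 by rewrite mulrNN star_pairing_sqr.
rewrite (skew_factor hs hN) !muM ?unitrMl ?unipotent_unit //.
by rewrite !mu_unipotent // !mulr1.
Qed.

(** This Gauss sum counts points: translating the summation variable by the
    isotropic subspace [(1 - N N^* ) P] and averaging over the translations leaves
    the [y] killed by [N^*], each with weight one. The sum is thus
    nonnegative, which fixes the sign left open by [fourier_det_sqr]. *)
Lemma sum_gamma_skew :
  \sum_y gamma s y = #|[set y : P | starA N *: y == 0]|%:R.
Proof.
have gE y : gamma s y = chi y (- (N *: y)).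
  rewrite /weil_gamma /weil_chi e1 mul1r scalerBl dotstarDr !dotstarNr.
  rewrite -dotstarZl // -[ds (N *: y) y](star_dotstar hs).
  have bs b : beta (star b) = beta (- b) by rewrite (beta_star hs heps hb hbe) e1 mul1r.
  rewrite opprB (betaD hb) bs mulrN mulr_natl mulr2n opprD (betaD hb).
  by rewrite mulrC.
have chiE (a : P) : \sum_w chi a w = if a == 0 then #|{: P}|%:R else 0.
  rewrite (eq_bigr (fun w => chi w (- (EA *: a)))) => [|w _]; last exact: chi_swapE.
  by rewrite sum_chi e1 scale1r oppr_eq0.
pose d : A := 1 - N * starA N.
have Nd : N * d = N.
  by rewrite mulrBr mulr1 mulrA pairing_sqr mul0r subr0.
have dN : starA d * N = 0.
  rewrite (starB hsA) (star1 hsA) (starM hsA) (starK hsA) mulrBl mul1r.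
  by rewrite (pairing_mulK hs hN) subrr.
have shift w : \sum_y gamma s y = \sum_y gamma s y * chi (- (starA N *: y)) w.
  rewrite (reindex_inj (addIr (d *: w))); apply: eq_bigr => y _.
  rewrite !gE scalerDr scalerA Nd chiDl (chiZ d) scalerN scalerDr !scalerA dN.
  rewrite !scale0r addr0 oppr0 chi0r mulr1 opprD chiDr; congr (_ * _).
  by rewrite chiNr chiNl chiZ (starK hsA).
apply: (mulfI card_neq0); rewrite mulr_natl -sumr_const (eq_bigr _ (fun w _ => shift w)).
rewrite exchange_big /= (eq_bigr (fun y =>
  if starA N *: y == 0 then #|{: P}|%:R else 0)) => [|y _].
  by rewrite -big_mkcond sumr_const mulr_natr cardsE.
rewrite -mulr_sumr chiE oppr_eq0; case: eqP => [y0|_]; last by rewrite mulr0.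
by rewrite gE chiNr -[N](starK hsA) -chiZ y0 chi0l invr1 mul1r.
Qed.

(** With [k] the number of points above, [c0 ^+ 2 * |P| = 1] and [c0 * k = 1], whence
    [k ^ 2 = |P|] in natural numbers. *)
Lemma det_split : c0 = #|B|%:R ^- n.
Proof.
have ss : pairing_skew star m * - s = 1 by rewrite mulrN (skew_sqr hs hN) opprK.
have ss' : - s * s = 1 by rewrite mulNr (skew_sqr hs hN) opprK.
have us : - s \is a GRing.unit by apply/unitrP; exists s.
have h := fourier_det_gauss 0 (eps_symN hsA heps skew_sym) us.
move: h; rewrite gamma0 mulr1 opprK mu_skew.
have -> : (- s)^-1 = s by apply: (mulrI us); rewrite mulrV // ss'.
under eq_bigr => y _ do rewrite chi0l mul1r.
rewrite sum_gamma_skew => ck.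
have c2 := fourier_det_sqr; move: c2; rewrite e1 (mu1 : mu R I (1 : A) = 1).
move: ck; move: (det_ratio e fourier) #|[set y | _]| => c k ck c2.
have kn : k = (#|B| ^ n)%N.
  apply/eqP; rewrite -(eqn_exp2r _ _ (isT : (0 < 2)%N)) -expnM mulnC -hN -card_colspace.
  have : k%:R ^+ 2 * (c ^+ 2 * #|{: P}|%:R) = #|{: P}|%:R.
    by rewrite mulrA -exprMn (mulrC _ c) ck expr1n mul1r.
  by rewrite c2 mulr1 -natrX => /eqP; rewrite eqr_nat.
have kc : c * #|B|%:R ^+ n = 1 by rewrite -natrX -kn.
have Bn : #|B|%:R ^+ n != 0 :> R[i].
  by apply: contra_eq_neq kc => ->; rewrite mulr0 eq_sym oner_eq0.
by apply: (mulIf Bn); rewrite kc mulVf.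
Qed.

End SplitCase.

Lemma weil_fE : c0 = weil_f star eps m beta n.
Proof.
rewrite /weil_f; case: heps => h; first by rewrite det_split // h.
rewrite h eqxx -(gauss_det h) [RHS]mulrC mulfK //.
apply: contraTneq (isT : true) => g0; have := gauss_det h.
by rewrite g0 mulr0 => /esym/eqP; rewrite signr_eq0.
Qed.

Theorem weil_is_data :
  is_data (A := A) (P := P) starA eps chi gamma (mu R I) (weil_f star eps m beta n).
Proof.
split; rewrite -?weil_fE.
- exact: chi_neq0.
- exact: chiDl.
- exact: chiDr.
- by move=> b x _; apply: gamma_neq0.
- by move=> t _; apply: mu_neq0.
- by move=> s t us ut; apply: muM.
- exact: weil_det_neq0 omega_weil.
- by move=> t x y ut; rewrite muM ?star_unit // mu_star // mu_sqr mul1r chiZ.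
- exact: chi_swap.
- exact: chi_nondeg.
- by move=> b b' x _ _; apply: gammaD.
- by move=> b t x _ _; apply: gammaZ.
- by move=> t x z ht _; apply: gamma_add.
- exact: fourier_det_sqr.
- by move=> t x ht ut; apply: fourier_det_gauss.
Qed.

Lemma bruhat_formulas_unique alpha f V V' :
  representation_on SSL V -> bruhat_formulas star eps e alpha gamma chi f V ->
  representation_on SSL V' -> bruhat_formulas star eps e alpha gamma chi f V' ->
  {in SSL, V' =1 V}.
Proof.
move=> [V1 VM] [Vh Vu Vo] [V'1 V'M] [Vh' Vu' Vo'].
pose G := [set g in SSL | V' g == V g].
have gG : group_set G.
  apply/group_setP; split; first by rewrite inE V1 V'1 eqxx andbT group1.
  move=> g k; rewrite !inE => /andP[gS /eqP eg] /andP[kS /eqP ek].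
  by rewrite (VM _ _ gS kS) (V'M _ _ gS kS) eg ek eqxx andbT groupM.
have sG : SSL \subset Group gG.
  apply: SSL_sub_group => [|t ut|r hr]; rewrite inE; apply/andP; split.
  - exact: omega_SSL.
  - by apply/eqP/(basis_eq he) => x; apply: etrans (Vo' x) (esym (Vo x)).
  - exact: h_SSL.
  - by apply/eqP/(basis_eq he) => x; apply: etrans (Vh' t x ut) (esym (Vh t x ut)).
  - exact: u_SSL.
  - by apply/eqP/(basis_eq he) => x; apply: etrans (Vu' r x hr) (esym (Vu r x hr)).
by move=> g /(fintype.subsetP sG); rewrite inE => /andP[_ /eqP].
Qed.

Theorem weil_on_SSL :
  unique_weil_on star eps beta e SSL (mu R I) gamma chi (weil_f star eps m beta n).
Proof.
exists W; split=> //; first exact: weil_representation.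
- by rewrite -weil_fE; exact: weil_formulas.
move=> V hV fV; apply: bruhat_formulas_unique weil_representation _ hV fV.
by rewrite -weil_fE; exact: weil_formulas.
Qed.

(** The last multiplicative hypothesis says that [SSL] is the kernel of a sign
    character of [G]. A representation of [G] twisted by that character satisfies
    the same formulas, hence would have to vanish outside [SSL]. *)
Lemma not_unique_weil (G : {set {unit matring A 1}}) (k : {unit matring A 1}) :
  {in G &, forall g g', (g * g')%g \in G} -> 1%g \in G -> SSL \subset G ->
  {in G &, forall g g', ((g * g')%g \in SSL) = ((g \in SSL) == (g' \in SSL))} ->
  k \in G -> k \notin SSL -> (k^-1)%g \in G ->
  ~ unique_weil_on star eps beta e G (mu R I) gamma chi (weil_f star eps m beta n).
Proof.
move=> GM G1 sG sgM kG kS kVG [V [[V1 VM] hf hu _]].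
pose V' g := if g \in SSL then V g else - V g.
have V'S g : g \in SSL -> V' g = V g by rewrite /V' => ->.
have rV' : representation_on G V'.
  split=> [|g g' gG g'G]; first by rewrite V'S ?group1.
  rewrite /V' sgM // VM //; case: (g \in SSL); case: (g' \in SSL) => //=.
  - by rewrite comp_lfunNr.
  - by rewrite comp_lfunNl.
  - by rewrite comp_lfunNl comp_lfunNr opprK.
have fV' : bruhat_formulas star eps e (mu R I) gamma chi (weil_f star eps m beta n) V'.
  case: hf => hh hu' ho; split=> [t x ut|r x hr|x].
  - by rewrite (V'S _ (h_SSL starA eps ut)) (hh t x ut).
  - by rewrite (V'S _ (u_SSL hr)) (hu' r x hr).
  - by rewrite (V'S _ (omega_SSL starA eps)) (ho x).
have := hu V' rV' fV' k kG; rewrite /V' (negPf kS) => /eqP.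
rewrite eq_sym -subr_eq0 opprK -mulr2n -scaler_nat scaler_eq0 (negPf two_neq0) /= => /eqP Vk.
have := VM k k^-1%g kG kVG; rewrite Vk comp_lfun0l mulgV V1 => /lfunP/(_ (e 0)).
rewrite id_lfunE zero_lfunE => e00.
by have /eqP := bcoord_basis he 0 0; rewrite e00 linear0 eqxx eq_sym oner_eq0.
Qed.

End WeilRepresentation.

(** * Finite local rings and their residue fields *)

Section FiniteRing.
Variable B : finUnitRingType.
Implicit Types x y : B.

(** Finiteness turns the injective left multiplication by [y] into a bijection,
    which gives [y] a right inverse too. *)
Lemma unit_of_right_inverse x y : x * y = 1 -> x \is a GRing.unit.
Proof.
move=> xy; have iy : injective ( *%R y) by move=> z z' h; rewrite -[z]mul1r -xy -mulrA h mulrA xy mul1r.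
have [g gK Kg] := injF_bij iy; have yg := Kg 1.
have gx : g 1 = x by rewrite -[g 1]mul1r -{1}xy -mulrA yg mulr1.
by apply/unitrP; exists y; split=> //; rewrite -gx; exact: yg.
Qed.

Lemma unit_of_left_inverse x y : y * x = 1 -> x \is a GRing.unit.
Proof.
move=> yx; have uy := unit_of_right_inverse yx.
have -> : x = y^-1 by rewrite -[x]mul1r -(mulVr uy) -mulrA yx mulr1.
by rewrite unitrV.
Qed.

Definition nonunits : {set B} := [set x | x \isn't a GRing.unit].

Hypothesis hloc : local_ring B.

Lemma right_ideal_mul x : right_ideal [set x * b | b in [set: B]].
Proof.
apply/and3P; split.
- by apply/imsetP; exists 0; rewrite ?inE ?mulr0.
- apply/forall_inP=> u /imsetP[b _ ->]; apply/forall_inP=> v /imsetP[c _ ->].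
  by apply/imsetP; exists (b - c); rewrite ?inE ?mulrBr.
- apply/forall_inP=> u /imsetP[b _ ->]; apply/forallP=> c.
  by apply/imsetP; exists (b * c); rewrite ?inE ?mulrA.
Qed.

(** Every proper right ideal lies in a maximal one, so all nonunits lie in the unique
    maximal right ideal, which contains no unit. *)
Lemma maximal_right_idealP K : maximal_right_ideal K = (K == nonunits).
Proof.
have [M [mM uM]] := hloc; suff -> : nonunits = M.
  by apply/idP/eqP => [/uM ->|->].
have [rM nM _] := and3P mM; have [M0 _ MM] := and3P rM.
apply/setP=> x; rewrite inE; apply/idP/idP => [nx|xM]; last first.
  apply: contraNN nM => ux; apply/eqP/setP=> b; rewrite inE.
  have /forall_inP/(_ x xM)/forallP/(_ (x^-1 * b)) := MM.
  by rewrite mulrA mulrV // mul1r.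
pose p (L : {set B}) := right_ideal L && (L != [set: B]).
have px : p [set x * b | b in [set: B]].
  rewrite /p right_ideal_mul; apply: contraNneq nx => h.
  have : 1 \in [set x * b | b in [set: B]] by rewrite h inE.
  by move=> /imsetP[b _ xb]; apply: (@unit_of_right_inverse x b).
have [L /maxsetP[/andP[rL nL] mL] sL] := maxset_exists px.
have -> : M = L.
  apply: uM; apply/and3P; split=> //; apply/forallP=> K'; apply/implyP=> /andP[rK' sK'].
  have [->|nK'] := eqVneq K' [set: B]; first by rewrite orbT.
  by rewrite orbF; apply/eqP/mL => //; rewrite /p rK'.
by apply: (fintype.subsetP sL); apply/imsetP; exists 1; rewrite ?inE ?mulr1.
Qed.

Lemma jacobson_radicalE : jacobson_radical B = nonunits.
Proof. by rewrite /jacobson_radical (eq_bigl _ _ maximal_right_idealP) big_pred1_eq. Qed.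

Lemma right_ideal_nonunits : right_ideal nonunits.
Proof. by have /and3P[] : maximal_right_ideal nonunits by rewrite maximal_right_idealP. Qed.

Lemma nonunitB x y : x \isn't a GRing.unit -> y \isn't a GRing.unit ->
  x - y \isn't a GRing.unit.
Proof.
move=> hx hy; have /and3P[_ /forall_inP h _] := right_ideal_nonunits.
have /h/forall_inP/(_ y) : x \in nonunits by rewrite inE.
by rewrite !inE => /(_ hy).
Qed.
Lemma nonunitMr x y : x \isn't a GRing.unit -> x * y \isn't a GRing.unit.
Proof.
by apply: contraNN => u; apply: (@unit_of_right_inverse _ (y * (x * y)^-1)); rewrite mulrA mulrV.
Qed.
Lemma nonunitMl x y : y \isn't a GRing.unit -> x * y \isn't a GRing.unit.
Proof.
by apply: contraNN => u; apply: (@unit_of_left_inverse _ ((x * y)^-1 * x)); rewrite -mulrA mulVr.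
Qed.

Definition nonunit : B -> bool := fun x => x \isn't a GRing.unit.

Fact nonunit_zmod_closed : zmod_closed nonunit.
Proof.
split; first by rewrite unfold_in /nonunit unitr0.
by move=> x y; rewrite !unfold_in; apply: nonunitB.
Qed.
HB.instance Definition _ := GRing.isZmodClosed.Build B nonunit nonunit_zmod_closed.

Definition nonunit_ideal : zmodClosed B := GRing.ZmodClosed.clone B nonunit _.
Definition residue : Type := Quotient.quot nonunit_ideal.
HB.instance Definition _ := GRing.Zmodule.copy residue (Quotient.quot nonunit_ideal).
Definition residue_pi : B -> residue := \pi_(Quotient.quot nonunit_ideal)%qT.
Definition residue_repr (x : residue) : B := repr (x : Quotient.quot nonunit_ideal).

Lemma residue_reprK (x : residue) : residue_pi (residue_repr x) = x.
Proof. exact: reprK. Qed.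
Lemma residue_pi_eq x y : (residue_pi x == residue_pi y) = (x - y \isn't a GRing.unit).
Proof. by rewrite -[RHS]/(x - y \in nonunit_ideal) Quotient.idealrBE. Qed.


Lemma residue_piB : {morph residue_pi : x y / x - y}.
Proof. exact: (raddfB \pi_(Quotient.quot nonunit_ideal)%qT). Qed.

Lemma residue_pi_repr x : residue_repr (residue_pi x) - x \isn't a GRing.unit.
Proof. by rewrite -residue_pi_eq residue_reprK. Qed.

Definition residue_mul (x y : residue) : residue :=
  residue_pi (residue_repr x * residue_repr y).

Lemma residue_piM : {morph residue_pi : x y / x * y >-> residue_mul x y}.
Proof.
move=> x y; apply/esym/eqP; rewrite residue_pi_eq.
set x' := residue_repr _; set y' := residue_repr _.
have -> : x' * y' - x * y = x' * (y' - y) - (x - x') * y.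
  by rewrite mulrBr mulrBl opprB addrA subrK.
apply: nonunitB; first by rewrite nonunitMl // residue_pi_repr.
by rewrite nonunitMr // -unitrN opprB residue_pi_repr.
Qed.

Lemma residue_piD : {morph residue_pi : x y / x + y}.
Proof. exact: (raddfD \pi_(Quotient.quot nonunit_ideal)%qT). Qed.

Fact residue_mulA : associative residue_mul.
Proof.
move=> x y z; rewrite -[x]residue_reprK -[y]residue_reprK -[z]residue_reprK.
by rewrite -!residue_piM mulrA.
Qed.
Fact residue_mul1 : left_id (residue_pi 1) residue_mul.
Proof. by move=> x; rewrite -[x]residue_reprK -residue_piM mul1r. Qed.
Fact residue_mul1r : right_id (residue_pi 1) residue_mul.
Proof. by move=> x; rewrite -[x]residue_reprK -residue_piM mulr1. Qed.
Fact residue_mulDl : left_distributive residue_mul +%R.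
Proof.
move=> x y z; rewrite -[x]residue_reprK -[y]residue_reprK -[z]residue_reprK.
by rewrite -residue_piD -!residue_piM -residue_piD mulrDl.
Qed.
Fact residue_mulDr : right_distributive residue_mul +%R.
Proof.
move=> x y z; rewrite -[x]residue_reprK -[y]residue_reprK -[z]residue_reprK.
by rewrite -residue_piD -!residue_piM -residue_piD mulrDr.
Qed.
Lemma residue_pi0 : residue_pi 0 = 0.
Proof. by rewrite -(subrr (0 : B)) residue_piB subrr. Qed.
Lemma residue_pi_eq0 x : (residue_pi x == 0) = (x \isn't a GRing.unit).
Proof. by rewrite -residue_pi0 residue_pi_eq subr0. Qed.
Fact residue_1neq0 : residue_pi 1 != 0.
Proof. by rewrite residue_pi_eq0 negbK unitr1. Qed.

HB.instance Definition _ := GRing.Zmodule_isNzRing.Build residue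
  residue_mulA residue_mul1 residue_mul1r residue_mulDl residue_mulDr residue_1neq0.
HB.instance Definition _ := Countable.copy residue (can_type residue_reprK).
HB.instance Definition _ : isFinite residue := CanIsFinite residue_reprK.

Definition residue_inv (x : residue) : residue := residue_pi (residue_repr x)^-1.
Definition residue_unit : pred residue := fun z => z != 0.

Lemma residue_repr_unit (x : residue) : (residue_repr x \is a GRing.unit) = (x != 0).
Proof. by rewrite -{2}[x]residue_reprK residue_pi_eq0 negbK. Qed.

Fact residue_mulVr : {in residue_unit, left_inverse 1 residue_inv *%R}.
Proof.
move=> x hx; rewrite -{2}[x]residue_reprK -[LHS]residue_piM mulVr //.
by rewrite residue_repr_unit.
Qed.
Fact residue_mulrV : {in residue_unit, right_inverse 1 residue_inv *%R}.
Proof.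
move=> x hx; rewrite -{1}[x]residue_reprK -[LHS]residue_piM mulrV //.
by rewrite residue_repr_unit.
Qed.
Fact residue_unitP (x y : residue) : y * x = 1 /\ x * y = 1 -> residue_unit x.
Proof. by case=> yx _; apply: contra_eq_neq yx => ->; rewrite mulr0 eq_sym oner_eq0. Qed.
Fact residue_inv_out : {in [predC residue_unit], residue_inv =1 id}.
Proof.
move=> x; rewrite inE negbK => /eqP ->; rewrite /residue_inv invr_out.
  by rewrite residue_reprK.
by rewrite residue_repr_unit eqxx.
Qed.
HB.instance Definition _ := GRing.NzRing_hasMulInverse.Build residue
  residue_mulVr residue_mulrV residue_unitP residue_inv_out.

Fact residue_domain : GRing.integral_domain_axiom residue.
Proof.
move=> x y xy; have [//|x0] := eqVneq x 0.
by apply/eqP; apply: (mulrI (x0 : x \is a GRing.unit)); rewrite xy mulr0.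
Qed.

Definition residue_field : finFieldType := @FinDomainFieldType (residue : finUnitRingType) residue_domain.

Definition to_residue : B -> residue_field := residue_pi.
Fact to_residue_zmod_morphism : zmod_morphism to_residue.
Proof. exact: residue_piB. Qed.
Fact to_residue_monoid_morphism : monoid_morphism to_residue.
Proof. by split; [|exact: residue_piM]. Qed.
HB.instance Definition _ := GRing.isZmodMorphism.Build B residue_field to_residue
  to_residue_zmod_morphism.
HB.instance Definition _ := GRing.isMonoidMorphism.Build B residue_field to_residue
  to_residue_monoid_morphism.

(** The quotient of a finite local ring by the ideal of its nonunits is a division
    ring, hence a field by Wedderburn's theorem. *)
Lemma local_residue_field : exists (F : finFieldType) (pi : {rmorphism B -> F}),
  (forall y : F, exists x, pi x = y) /\
  (forall x, (pi x == 0) = (x \isn't a GRing.unit)).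
Proof.
exists residue_field, (GRing.RMorphism.clone _ _ to_residue _); split.
  by move=> y; exists (residue_repr y); exact: residue_reprK.
exact: residue_pi_eq0.
Qed.

End FiniteRing.

(** * Reduction modulo the radical *)

Lemma unit_of_injective (A : finUnitRingType) (a : A) :
  (forall b, a * b = 0 -> b = 0) -> a \is a GRing.unit.
Proof.
move=> h; have ia : injective ( *%R a).
  by move=> x y xy; apply/eqP; rewrite -subr_eq0; apply/eqP/h; rewrite mulrBr xy subrr.
have [g _ Kg] := injF_bij ia; apply: (@unit_of_right_inverse _ a (g 1)); exact: Kg.
Qed.

(** Nakayama's lemma for a local ring, by eliminating one coordinate at a time. *)
Lemma nonunit_fixed (B : finUnitRingType) (hloc : local_ring B) (k : nat)
    (f : 'I_k -> 'I_k -> B) (v : 'I_k -> B) :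
  (forall i j, f i j \isn't a GRing.unit) ->
  (forall i, v i = \sum_j f i j * v j) -> forall i, v i = 0.
Proof.
have nD x y : x \isn't a GRing.unit -> y \isn't a GRing.unit -> x + y \isn't a @GRing.unit B.
  by move=> hx hy; rewrite -[y]opprK nonunitB // unitrN.
elim: k f v => [|k IHk] f v hf hv; first by case.
have u00 : 1 - f ord0 ord0 \is a GRing.unit.
  apply: contraT => h; have := nD _ _ h (hf ord0 ord0).
  by rewrite subrK unitr1.
have v0 : v ord0 = (1 - f ord0 ord0)^-1 * \sum_j f ord0 (lift ord0 j) * v (lift ord0 j).
  apply: (mulrI u00); rewrite mulVKr // mulrBl mul1r {1}hv big_ord_recl addrC.
  by rewrite addKr.
have vS j : v (lift ord0 j) = 0.
  apply: (IHk (fun i j => f (lift ord0 i) ord0 * (1 - f ord0 ord0)^-1 * f ord0 (lift ord0 j)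
             + f (lift ord0 i) (lift ord0 j)) (fun i => v (lift ord0 i))).
    by move=> i l; rewrite nD // -mulrA nonunitMr.
  move=> i; rewrite {1}hv big_ord_recl {1}v0 mulrA mulr_sumr -big_split.
  by apply: eq_bigr => l _; rewrite mulrDl mulrA.
move=> i; case: (unliftP ord0 i) => [j ->|->]; first exact: vS.
by rewrite v0 big1 ?mulr0 // => j _; rewrite vS mulr0.
Qed.

Section LocalRing.
Variables (B : finUnitRingType) (hloc : local_ring B).
Variables (star : B -> B) (hs : is_involution star).
Variables (eps : int) (heps : eps = 1 \/ eps = -1).
Hypothesis h2 : (2%:R : B) \is a GRing.unit.
Variable m : nat.
Local Notation A := (matring B m).
Local Notation starA := (@star_trmx B star m).
Local Notation SL := (@SLstar A starA eps).
Local Notation SSL := (@SSLstar A starA eps).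
Local Notation sym := (@eps_sym A starA eps).
Local Notation EA := (eps%:~R : A).
Let hsA : is_involution starA := star_trmx_involution hs m.

Variables (F : finFieldType) (rho : {rmorphism B -> F}).
Hypothesis rho_surj : forall y : F, exists x, rho x = y.
Hypothesis rho0 : forall x, (rho x == 0) = (x \isn't a GRing.unit).

Definition red (M : A) : 'M[F]_m.+1 := map_mx rho M.

Lemma redM M N : red (M * N) = red M *m red N. Proof. exact: map_mxM. Qed.
Lemma redD M N : red (M + N) = red M + red N. Proof. exact: map_mxD. Qed.
Lemma redN M : red (- M) = - red M. Proof. exact: map_mxN. Qed.
Lemma redB M N : red (M - N) = red M - red N. Proof. exact: map_mxB. Qed.
Lemma red1 : red 1 = 1%:M. Proof. exact: map_mx1. Qed.
Lemma red_eps : red EA = (eps%:~R)%:M.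
Proof. by case: heps => ->; rewrite ?mulrNz !mulr1z ?redN red1 // raddfN. Qed.

Lemma red_surj (M : 'M[F]_m.+1) : exists N : A, red N = M.
Proof.
pose lift (y : F) : B := odflt 0 [pick x | rho x == y].
have liftK y : rho (lift y) = y.
  rewrite /lift; case: pickP => [x /eqP //|h].
  by have [x xy] := rho_surj y; move: (h x); rewrite xy eqxx.
exists (map_mx lift M : 'M_m.+1); apply/matrixP=> i j; rewrite !mxE; exact: liftK.
Qed.

(** A right annihilator of [M] is fixed by [1 - N * M], where [N] lifts the inverse of
    the reduction of [M]; the entries of that matrix are nonunits. *)
Lemma red_unit (M : A) : red M \in unitmx -> M \is a GRing.unit.
Proof.
move=> uM; have [N hN] := red_surj (invmx (red M)); apply: unit_of_injective => b Mb.
apply/matrixP=> i j; rewrite [RHS]mxE.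
pose K := 1 - N * M; have Kb : b = K * b by rewrite mulrBl mul1r -mulrA Mb mulr0 subr0.
have K0 k l : (K : 'M_m.+1) k l \isn't a GRing.unit.
  have /matrixP/(_ k l) : red K = 0 by rewrite redB red1 redM hN mulVmx // subrr.
  by rewrite !mxE => /eqP; rewrite rho0.
apply: (nonunit_fixed hloc K0 (v := fun i => (b : 'M_m.+1) i j)) => k.
by rewrite [in LHS]Kb mxE.
Qed.

Lemma unit_red (M : A) : M \is a GRing.unit -> red M \in unitmx.
Proof.
move=> uM; have : red M *m red M^-1 = 1%:M by rewrite -redM mulrV // red1.
by case/mulmx1_unit.
Qed.

Lemma redV (M : A) : M \is a GRing.unit -> red M^-1 = invmx (red M).
Proof.
move=> uM; rewrite -[RHS]mul1mx -red1 -(mulVr uM) redM mulmxK //.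
exact: unit_red.
Qed.

Lemma rho_star x y : rho x = rho y -> rho (star x) = rho (star y).
Proof.
move=> h; apply/eqP; rewrite -subr_eq0 -rmorphB -(starB hs) rho0.
have : x - y \isn't a GRing.unit by rewrite -rho0 rmorphB h subrr.
apply: contraNN => u; rewrite -[_ - _](starK hs); exact: star_unit.
Qed.

Lemma red_star M N : red M = red N -> red (starA M) = red (starA N).
Proof.
move=> h; apply/matrixP=> i j; rewrite !mxE; apply: rho_star.
by have /matrixP/(_ j i) := h; rewrite !mxE.
Qed.

Definition pidA (r : nat) : A := (pid_mx r : 'M[B]_m.+1).

Lemma red_pid r : red (pidA r) = pid_mx r.
Proof. exact: map_pid_mx. Qed.
Lemma star_pid r : starA (pidA r) = pidA r.
Proof.
apply/matrixP=> i j; rewrite !mxE eq_sym; case: eqP => [->|_] /=; rewrite ?(star_nat hs) //.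
Qed.

(** * Elements outside the big cell *)

Section FirstColumn.
Variable g : {unit matring A 1}.
Hypothesis gSL : g \in SL.
Local Notation a := (ent g 0 0).
Local Notation c := (ent g 1 0).
Variable r : nat.
Hypothesis rc : red c = pid_mx r.
Local Notation E := (pid_mx r : 'M[F]_m.+1).

Hypothesis hr : (r <= m.+1)%N.
Let EE : E *m E = E. Proof. exact: pid_mx_id. Qed.

Lemma red_isotropic : red (starA a) *m E = - (red EA *m E *m red a).
Proof.
have := gSL; rewrite inE => /and3P[/eqP h _ _].
have rcs : red (starA c) = E by rewrite (red_star (N := pidA r)) ?star_pid red_pid.
by rewrite -{1}rc -redM h redN !redM rcs.
Qed.

(** The two sides of [red_isotropic] are supported on [E] from different sides. *)
Lemma red_corner : E *m red a = E *m red a *m E.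
Proof.
have := red_isotropic; rewrite red_eps => h.
have h' := congr1 (fun M => M *m E) h; move: h'; rewrite -mulmxA EE h mulNmx => /oppr_inj.
have z0 : (eps%:~R : F) != 0.
  by case: heps => ->; rewrite ?mulrNz mulr1z ?oppr_eq0 oner_eq0.
rewrite !mul_scalar_mx -!scalemxAl; apply: scalerI z0 _ _.
Qed.

Variable s : A.
Hypothesis ss : sym s.
Hypothesis us : red s \in unitmx.
Hypothesis sE : red s *m E = E *m red s.

(** As [c] reduces to the projection [E], adding [R * c] to [a] with [R] supported on
    the corner [E] changes only that corner. The corner of [a] is itself
    [eps]-symmetric, so it can be exchanged for that of the invertible [s]; the
    first column being unimodular, the result is injective. *)
Lemma unit_corner_translate : exists2 R : A, sym R & a + R * c \is a GRing.unit.
Proof.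
pose Q : A := pidA r * (s - a) * pidA r.
have u2 : (2%:R : A) \is a GRing.unit := matring_unit2 m h2.
pose t : A := 2%:R^-1.
have tC x : t * x = x * t by apply/esym: (commrV (commr_nat x 2)).
have st : starA t = t by rewrite (starV hsA) // (star_nat hsA).
have zz : (eps%:~R * eps%:~R : F) = 1.
  by case: heps => ->; rewrite ?mulrNz !mulr1z ?mulrNN mulr1.
have redQ : red (starA Q) = - (eps%:~R *: red Q).
  have ess : red (starA s) = - (red EA *m red s).
    by move/(eps_symP _ heps): ss => ->; rewrite redN redM.
  rewrite /Q !(starM hsA) (starB hsA) star_pid !redM !redB red_pid mulmxBl red_isotropic.
  rewrite ess red_eps !mul_scalar_mx -?scalemxAl opprK.
  rewrite mulNmx -scalemxAl mulmxDr mulmxN -!scalemxAr !mulmxA EE [in RHS]mulmxBr mulmxBl.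
  by rewrite -red_corner scalerBr opprB addrC.
have symR (Q0 : A) : sym (t * (Q0 - EA * starA Q0)).
  apply/(eps_symP _ heps); rewrite (starM hsA) (starB hsA) (starM hsA) (starK hsA) st.
  rewrite (star_eps hsA heps) -(epsC heps Q0) -tC (mulrA EA t) (epsC heps t).
  by rewrite -(mulrA t) [EA * (_ - _)]mulrBr (epsK heps) -[RHS]mulrN opprB.
(* Skew-symmetrizing [Q] does not change its reduction, which is skew already. *)
pose R : A := t * (Q - EA * starA Q).
have redR : red R = red Q.
  rewrite redM redB redM redQ red_eps mul_scalar_mx scalerN scalerA zz scale1r opprK.
  by rewrite -redD -mulr2n -mulr_natl -redM mulKr.
exists R; first exact: symR.
apply: red_unit; rewrite redD redM redR /Q !redM redB red_pid rc.
rewrite -(mulmxA _ E E) EE mulmxBr mulmxBl -red_corner.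
apply: (@unit_of_injective 'M[F]_m.+1) => V; rewrite -[_ * V]/(_ *m V) => aV.
have EV : E *m V = 0.
  have := congr1 (mulmx E) aV; rewrite mulmx0 mulmxA mulmxDr mulmxBr !mulmxA EE addrC subrK.
  by rewrite -sE -(mulmxA _ E E) EE -mulmxA => /(congr1 (mulmx (invmx (red s)))); rewrite mulKmx // mulmx0.
have aV0 : red a *m V = 0.
  move: aV; rewrite mulmxDl mulmxBl -(mulmxA _ E V) EV mulmx0 red_corner -(mulmxA _ E V) EV.
  by rewrite mulmx0 subrr addr0.
have := gSL; rewrite inE => /and3P[_ _ /eqP h].
have := congr1 (fun M => red M *m V) h.
by rewrite red1 mul1mx redD !redM mulmxDl -!mulmxA aV0 rc EV !mulmx0 addr0.
Qed.

End FirstColumn.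

(** Gaussian elimination over the residue field, lifted to diagonal elements of the
    group acting on both sides. *)
Lemma rank_normal_form (g : {unit matring A 1}) : g \in SL ->
  exists h k, [/\ h \in SSL, k \in SSL, (h * g * k)%g \in SL &
    red (ent (h * g * k)%g 1 0) = pid_mx (\rank (red (ent g 1 0)))].
Proof.
move=> gSL; set c := red (ent g 1 0).
have [L hL] := red_surj (col_ebase c); have [U hU] := red_surj (row_ebase c).
have uL : L \is a GRing.unit by rewrite red_unit // hL col_ebase_unit.
have uU : U \is a GRing.unit by rewrite red_unit // hU row_ebase_unit.
have uT : starA L \is a GRing.unit := star_unit hsA uL.
have uS : U^-1 \is a GRing.unit by rewrite unitrV.
have hS := h_SSL starA eps uT; have kS := h_SSL starA eps uS.
have sub := fintype.subsetP (SSL_sub_SL hsA heps).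
exists (bruhat_h starA (starA L)), (bruhat_h starA U^-1); split; [exact: hS | exact: kS | | ].
  exact: (SLM hsA heps (SLM hsA heps (sub _ hS) gSL) (sub _ kS)).
have := bruhat_hE hsA uT; have := bruhat_hE hsA uS.
move: (bruhat_h starA (starA L)) (bruhat_h starA U^-1) => h k ek eh.
have e : val (h * g * k)%g = mx22 (starA L) 0 0 (starA (starA L))^-1 * val g *
    mx22 U^-1 0 0 (starA U^-1)^-1 by rewrite !FinRing.val_unitM eh ek.
rewrite (val_mx22 g) !mul_mx22 (starK hsA) in e; have [_ _ -> _] := ent_mx22 e.
rewrite !mul0r !mulr0 add0r addr0 !redM !redV // hL hU -/c.
rewrite -[X in _ *m X *m _](mulmx_ebase c) -!mulmxA mulmxV ?row_ebase_unit // mulmx1.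
by rewrite mulKmx ?col_ebase_unit.
Qed.

(** In normal form the lower left block reduces to a projection; the skew matrix [s]
    then moves the element into the big cell. Only the existence of [s]
    distinguishes the three cases below. *)
Lemma rank_criterion (g : {unit matring A 1}) (s : A) : g \in SL ->
  sym s -> red s \in unitmx ->
  red s *m pid_mx (\rank (red (ent g 1 0))) = pid_mx (\rank (red (ent g 1 0))) *m red s ->
  g \in SSL.
Proof.
move=> gSL ss us sE; have [h [k [hS kS g'SL rc]]] := rank_normal_form gSL.
have hr : (\rank (red (ent g 1%R 0%R)) <= m.+1)%N by rewrite rank_leq_row.
have [R sR uR] := unit_corner_translate g'SL rc hr ss us sE.
suff g'S : (h * g * k)%g \in SSL.
  exact: SSL_cancell hS (SSL_cancelr kS g'S).
apply: (SSL_cancell (u_SSL sR)); apply: (unit_corner_SSL hsA heps).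
  apply: (SLM hsA heps _ g'SL); apply: (fintype.subsetP (SSL_sub_SL hsA heps)); exact: u_SSL.
move: (h * g * k)%g uR => g' uR; have := bruhat_uE R; move: (bruhat_u R) => u eu.
have e : val (u * g')%g = mx22 1 R 0 1 * val g' by rewrite FinRing.val_unitM eu.
rewrite (val_mx22 g') mul_mx22 in e; have [-> _ _ _] := ent_mx22 e.
by rewrite mul1r.
Qed.

Lemma SSL_symplectic : eps = -1 -> SL = SSL.
Proof.
move=> h; apply/eqP; rewrite finset.eqEsubset (SSL_sub_SL hsA heps) andbT.
apply/fintype.subsetP=> g gSL; apply: (@rank_criterion g 1) => //.
- by rewrite /eps_sym h (star1 hsA) mulr1 addrN.
- by rewrite red1 unitmx1.
- by rewrite red1 mul1mx mulmx1.
Qed.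

Lemma SSL_unramified : eps = 1 -> ~ ramified star -> SL = SSL.
Proof.
move=> h nr; have [b ub] : exists b, star b - b \is a GRing.unit.
  apply/existsP; apply: contraT => /existsPn hn; case: nr => b.
  by rewrite (jacobson_radicalE hloc) inE hn.
set d := star b - b in ub.
have sd : star d = - d by rewrite (starB hs) (starK hs) opprB.
apply/eqP; rewrite finset.eqEsubset (SSL_sub_SL hsA heps) andbT.
have ed : red (d%:M : 'M_m.+1) = (rho d)%:M by rewrite /red map_scalar_mx.
apply/fintype.subsetP=> g gSL; apply: (@rank_criterion g (d%:M : 'M_m.+1)) => //.
- apply/(eps_symP _ heps); rewrite h mul1r; apply/matrixP=> i j; rewrite !mxE eq_sym.
  by case: (i == j); rewrite ?mulr1n ?mulr0n ?(star0 hs) ?oppr0.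
- rewrite ed unitmxE det_scalar unitfE expf_neq0 //.
  by rewrite rho0 negbK.
- by rewrite ed scalar_mxC.
Qed.

(** * The split orthogonal case *)

Section Ramified.
Variable n : nat.
Hypothesis hm : m.+1 = (2 * n)%N.
Hypothesis e1 : eps = 1.
Hypothesis hr : ramified star.
Local Notation N := (pairing B m).
Local Notation skw := (pairing_skew star m).

Lemma rho_ramified x : rho (star x) = rho x.
Proof.
apply/eqP; rewrite -subr_eq0 -rmorphB rho0.
by have := hr x; rewrite (jacobson_radicalE hloc) inE.
Qed.

Lemma red_star_ramified M : red (starA M) = (red M)^T.
Proof. by apply/matrixP=> i j; rewrite !mxE rho_ramified. Qed.

Lemma rho2 : (2%:R : F) != 0.
Proof. by rewrite -(rmorph_nat rho) rho0 negbK. Qed.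

Lemma pid_pairing r : ~~ odd r -> pidA r * N = N * pidA r.
Proof.
move=> er; apply/matrixP=> i j; rewrite !mxE.
rewrite (bigD1 i) //= big1 ?addr0 => [|k ki]; last by rewrite !mxE (inj_eq val_inj) eq_sym (negPf ki) mul0r.
rewrite (bigD1 j) //= big1 ?addr0 => [|k kj]; last by rewrite !mxE (inj_eq val_inj) (negPf kj) mulr0.
rewrite !mxE !eqxx /=.
have [ij|_] := eqVneq (j : nat) i.+1; last by rewrite andbF mul0r mulr0.
case ei : (odd i); first by rewrite mul0r mulr0.
rewrite ij mul1r mulr1; congr (_ %:R); congr nat_of_bool.
apply/idP/idP => [ir|/ltnW //]; rewrite ltn_neqAle ir andbT.
by apply: contraNneq er => <-; rewrite /= ei.
Qed.

Lemma even_rank_SSL g : g \in SL -> ~~ odd (\rank (red (ent g 1 0))) -> g \in SSL.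
Proof.
move=> gSL er; have us : skw \is a GRing.unit := pairing_skew_unit hs hm.
apply: (@rank_criterion g skw) => //; [|exact: unit_red|].
  by rewrite e1; exact: pairing_skew_sym.
have pN := pid_pairing er; have pN' := congr1 starA pN.
rewrite !(starM hsA) star_pid in pN'.
by rewrite -red_pid -!redM mulrBl mulrBr pN pN'.
Qed.

(** The reflection exchanging the basis vectors [u_j] and [v_j]. *)
Definition swap_mx j : matring A 1 :=
  let d : A := (delta_mx j j : 'M[B]_m.+1) in mx22 (1 - d) d d (1 - d).
Definition swap j : {unit matring A 1} := insubd (1%g : {unit matring A 1}) (swap_mx j).

Lemma delta_idem j : (delta_mx j j : A) * (delta_mx j j : A) = delta_mx j j.
Proof. exact: mul_delta_mx. Qed.

Lemma swapE j : val (swap j) = swap_mx j.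
Proof.
rewrite insubdK //; have dd := delta_idem j.
apply: unitr_of_sqr1; rewrite mul_mx22 -mx22_1.
move: (delta_mx j j : A) dd => d dd.
have h1 : (1 - d) * (1 - d) + d * d = 1.
  by rewrite mulrBr mulr1 mulrBl mul1r dd subrr subr0 subrK.
have h2' : (1 - d) * d = 0 by rewrite mulrBl mul1r dd subrr.
have h3 : d * (1 - d) = 0 by rewrite mulrBr mulr1 dd subrr.
congr mx22; [exact: h1 | | | by rewrite addrC; exact: h1].
  by apply: (etrans (congr2 +%R h2' h3)); rewrite addr0.
by apply: (etrans (congr2 +%R h3 h2')); rewrite addr0.
Qed.

Lemma swap_ent j : let d : A := (delta_mx j j : 'M[B]_m.+1) in
  [/\ ent (swap j) 0 0 = 1 - d, ent (swap j) 0 1 = d,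
      ent (swap j) 1 0 = d & ent (swap j) 1 1 = 1 - d].
Proof. exact: ent_mx22 (swapE j). Qed.

Lemma swap_SL j : swap j \in SL.
Proof.
rewrite inE; have [-> -> -> ->] := swap_ent j; cbv zeta.
have sd : starA (delta_mx j j : A) = delta_mx j j.
  apply/matrixP=> i k; rewrite !mxE andbC.
  by case: (_ && _); rewrite ?(star1 hs) ?(star0 hs).
have := delta_idem j; rewrite e1 mul1r.
move: (delta_mx j j : A) sd => d sd dd.
rewrite (starB hsA) (star1 hsA) sd !mul1r.
have h1 : d * (1 - d) = 0 by rewrite mulrBr mulr1 dd subrr.
have h3 : (1 - d) * d = 0 by rewrite mulrBl mul1r dd subrr.
have h4 : (1 - d) * (1 - d) + d * d = 1.
  by rewrite mulrBr mulr1 h3 subr0 dd subrK.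
by apply/and3P; split; apply/eqP; rewrite ?h1 ?h3 ?oppr0.
Qed.

(** The new row [j] of the lower left block is that of [a], which has zero entry in
    column [j], its corner being alternating; elementary operations then clear it. *)
Lemma swap_rank g r (j : 'I_m.+1) : g \in SL -> red (ent g 1 0) = pid_mx r.+1 ->
  j = r :> nat -> \rank (red (ent (swap j * g)%g 1 0)) = r.
Proof.
move=> gSL rc jr; have hr1 : (r.+1 <= m.+1)%N by rewrite -jr.
rewrite ent_mul; have [_ _ -> ->] := swap_ent j.
set a := red (ent g 0 0); set d : 'M[F]_m.+1 := delta_mx j j.
have rd : red (delta_mx j j : A) = d by rewrite /red map_delta_mx.
rewrite redD !redM redB red1 rd rc -/a.
have dE : d *m pid_mx r.+1 = d.
  apply/matrixP=> i k; rewrite !mxE (bigD1 j) //= big1 ?addr0 => [|l lj].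
    rewrite !mxE eqxx andbT; case: eqVneq => _; rewrite ?mul1r ?mul0r //= .
    rewrite (inj_eq val_inj) eq_sym; case: eqVneq => //= _.
    by rewrite jr ltnSn.
  by rewrite mxE (negPf lj) andbF mul0r.
have dd : d *m d = d by rewrite mul_delta_mx.
have corner := red_corner gSL rc hr1; rewrite -/a in corner.
have pE : pid_mx r.+1 = pid_mx r + d :> 'M[F]_m.+1.
  apply/matrixP=> i k; rewrite !mxE ltnS leq_eqVlt -jr.
  rewrite !(inj_eq val_inj); have [<-|ik] := eqVneq i k.
    by case: eqVneq => [->|_]; rewrite ?ltnn ?add0r ?addr0.
  rewrite add0r; case: eqVneq => [ij|//]; case: eqVneq => [kj|//].
  by rewrite ij kj eqxx in ik.
have dad : d *m a *m d = 0.
  have ajj : a j j = 0.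
    have := red_isotropic gSL rc; rewrite red_star_ramified red_eps e1 mul1mx -/a.
    move=> /matrixP/(_ j j); rewrite !mxE (bigD1 j) //= big1 ?addr0 => [|l lj]; last first.
      by rewrite !mxE (inj_eq val_inj) (negPf lj) mulr0.
    rewrite (bigD1 j) //= big1 ?addr0 => [|l lj]; last first.
      by rewrite !mxE (inj_eq val_inj) eq_sym (negPf lj) mul0r.
    rewrite !mxE eqxx jr ltnSn mulr1 mul1r => /eqP; rewrite -addr_eq0 -mulr2n -mulr_natl.
    by rewrite mulf_eq0 (negPf rho2) => /eqP.
  apply/matrixP=> i k; rewrite mxE [RHS]mxE big1 // => l _; rewrite !mxE.
  have [lj|] := eqVneq l j; last by rewrite mulr0.
  rewrite (bigD1 j) //= big1 ?addr0 => [|q qj]; last by rewrite !mxE (negPf qj) andbF mul0r.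
  by rewrite lj ajj mulr0 mul0r.
have da : d *m a = d *m a *m pid_mx r.
  by rewrite -{1}dE -mulmxA corner !mulmxA dE pE mulmxDr dad addr0.
have -> : d *m a + (1%:M - d) *m pid_mx r.+1 = (1%:M + d *m a) *m pid_mx r.
  rewrite mulmxBl mul1mx dE pE addrK mulmxDl mul1mx -da addrC.
  by [].
have uda : 1%:M + d *m a \in unitmx.
  have : (1%:M + d *m a) *m (1%:M - d *m a) = 1%:M.
    rewrite mulmxBr mulmx1 mulmxDl mul1mx mulmxA dad mul0mx addr0 addrK.
    by [].
  by case/mulmx1_unit.
rewrite (eqmxMfull _ _) ?row_full_unit // rank_pid_mx //.
  by apply: ltnW.
by apply: ltnW.
Qed.

(** On [SL] this takes the values 1 and -1 only, and [SSL] is its kernel. *)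
Definition red_det (g : {unit matring A 1}) : F :=
  \det (block_mx (red (ent g 0 0)) (red (ent g 0 1)) (red (ent g 1 0)) (red (ent g 1 1))).

Lemma red_detM g k : red_det (g * k)%g = red_det g * red_det k.
Proof. by rewrite /red_det -det_mulmx mulmx_block !ent_mul !redD !redM. Qed.

Lemma red_detE g a b c d : val g = mx22 a b c d ->
  red_det g = \det (block_mx (red a) (red b) (red c) (red d)).
Proof. by move=> /ent_mx22[<- <- <- <-]. Qed.

Lemma red_det1 : red_det 1%g = 1.
Proof.
have h : val (1%g : {unit matring A 1}) = mx22 1 0 0 1 := esym (mx22_1 A).
by rewrite (red_detE h) red1 /red raddf0 -scalar_mx_block det1.
Qed.

Lemma red_det_neq0 g : red_det g != 0.
Proof.
have /eqP := red_detM g g^-1; rewrite mulgV red_det1; apply: contraTneq => ->.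
by rewrite mul0r oner_eq0.
Qed.

Lemma red_det_u r : red_det (bruhat_u r) = 1.
Proof. by rewrite (red_detE (bruhat_uE r)) /red raddf0 -/(red 1) red1 det_ublock !det1 mulr1. Qed.

Lemma red_det_h t : t \is a GRing.unit -> red_det (bruhat_h starA t) = 1.
Proof.
move=> ut; have ust := star_unit hsA ut.
rewrite (red_detE (bruhat_hE hsA ut)) /red !raddf0 -!/(red _) det_ublock.
rewrite redV // red_star_ramified det_inv det_tr mulfV //.
by have := unit_red ut; rewrite unitmxE unitfE.
Qed.

(** The Bruhat relation contains [omega] twice on one side and once on the other. *)
Lemma red_det_omega : red_det (bruhat_omega A eps) = 1.
Proof.
have us : skw \is a GRing.unit := pairing_skew_unit hs hm.
have hsk : sym skw by rewrite e1; exact: pairing_skew_sym.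
have uNs : - skw \is a GRing.unit by rewrite unitrN.
have dL w u u' : red_det u = 1 -> red_det u' = 1 ->
    red_det (w * u * w * u')%g = red_det w * red_det w.
  by move=> du du'; rewrite !red_detM du du' !mulr1.
have dR w u h : red_det u = 1 -> red_det h = 1 -> red_det (u * h * w)%g = 1 * red_det w.
  by move=> du dh; rewrite !red_detM du dh mulr1.
have := etrans (esym (dL _ _ _ (red_det_u _) (red_det_u _)))
  (etrans (congr1 red_det (bruhat_relation hsA heps hsk us))
          (dR _ _ _ (red_det_u _) (red_det_h uNs))).
by move/(mulIf (red_det_neq0 _)).
Qed.

Lemma red_det_SSL g : g \in SSL -> red_det g = 1.
Proof.
pose G := [set g | red_det g == 1].
have gG : group_set G.
  apply/group_setP; split; first by rewrite inE red_det1.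
  by move=> x y; rewrite !inE red_detM => /eqP -> /eqP ->; rewrite mulr1.
have sG : SSL \subset Group gG.
  apply: SSL_sub_group => [|t ut|r _]; rewrite inE; apply/eqP.
  - exact: red_det_omega.
  - exact: red_det_h.
  - exact: red_det_u.
by move=> /(fintype.subsetP sG); rewrite inE => /eqP.
Qed.

(** Up to the reflection [1 - 2 d], the element [swap j] is a product of unipotents. *)
Lemma red_det_swap j : red_det (swap j) = -1.
Proof.
rewrite (red_detE (swapE j)) redB red1.
have -> : red (delta_mx j j : A) = delta_mx j j by rewrite /red map_delta_mx.
set d : 'M[F]_m.+1 := delta_mx j j; have dd : d *m d = d by rewrite mul_delta_mx.
have -> : block_mx (1%:M - d) d d (1%:M - d) =
    block_mx 1%:M 0 0 (1%:M - d *+ 2) *m (block_mx 1%:M d 0 1%:M *m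
    (block_mx 1%:M 0 (- d) 1%:M *m block_mx 1%:M d 0 1%:M)).
  rewrite !mulmx_block !(mulmx0, mul0mx, mulmx1, mul1mx, addr0, add0r) mulmxN mulNmx dd.
  congr block_mx; rewrite ?mulmxBl ?mulmxBr ?mulmxN ?mul1mx ?mulmx1 ?mulmxDr ?mulmxDl ?dd.
  - by rewrite mulmxN mulmx1 dd addNr addr0.
  - by rewrite opprK addrA addNr add0r.
  - by rewrite mulmxN mulmx1 dd -opprD addNr subr0 addrC.
rewrite !det_mulmx !det_ublock !det_lblock !det1 !mulr1 !mul1r.
have -> : 1%:M - d *+ 2 = diag_mx (\row_i (1 - (i == j)%:R *+ 2)).
  apply/matrixP=> i k; rewrite !mxE; have [<-|ik] := eqVneq i k.
    by rewrite andbb mulr1n.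
  rewrite mulr0n sub0r; case: eqVneq => [ij|_]; last by rewrite /= addr0 oppr0.
  case: eqVneq => [kj|_]; last by rewrite /= addr0 oppr0.
  by rewrite ij kj eqxx in ik.
rewrite det_diag (bigD1 j) //= big1 => [|i ij].
  by rewrite mxE eqxx mulr1 mulr2n opprD addrA subrr add0r.
by rewrite mxE (negPf ij) mul0rn subr0.
Qed.

Lemma opp1_neq1 : (-1 : F) != 1.
Proof. by rewrite eq_sym -addr_eq0 -mulr2n -[1 *+ 2]/(2%:R) rho2. Qed.

(** When the rank is odd, a reflection makes it even, and the even case applies. *)
Lemma odd_rank_det g : g \in SL -> odd (\rank (red (ent g 1 0))) -> red_det g = -1.
Proof.
move=> gSL; case er : (\rank (red (ent g 1 0))) => [//|r] /= or.
have [h [k [hS kS g'SL rc]]] := rank_normal_form gSL; rewrite er in rc.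
have rm : (r < m.+1)%N by rewrite -er rank_leq_row.
pose j := Ordinal rm.
have sSL : (swap j * (h * g * k))%g \in SL := SLM hsA heps (swap_SL j) g'SL.
have sS : (swap j * (h * g * k))%g \in SSL.
  by apply: even_rank_SSL => //; rewrite (swap_rank (r := r)).
have := red_det_SSL sS; rewrite !red_detM red_det_swap (red_det_SSL hS) (red_det_SSL kS).
by rewrite mul1r mulr1 mulN1r => <-; rewrite opprK.
Qed.

Lemma mem_SSL g : g \in SL -> (g \in SSL) = (red_det g == 1).
Proof.
move=> gSL; apply/idP/eqP => [/red_det_SSL //|d1]; apply: even_rank_SSL => //.
by apply/negP => /(odd_rank_det gSL) d; have := opp1_neq1; rewrite -d d1 eqxx.
Qed.

Lemma red_det_sign g : g \in SL -> red_det g = if g \in SSL then 1 else -1.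
Proof.
move=> gSL; case: ifPn => [/red_det_SSL //|gS]; apply: odd_rank_det => //.
by apply: contraNT gS; apply: even_rank_SSL.
Qed.

Lemma mem_SSL_mul : {in SL &, forall g k, ((g * k)%g \in SSL) = ((g \in SSL) == (k \in SSL))}.
Proof.
move=> g k gSL kSL; rewrite (mem_SSL (SLM hsA heps gSL kSL)) red_detM !red_det_sign //.
have /negPf n1 := opp1_neq1.
by do 2![case: (_ \in SSL)]; rewrite ?mulr1 ?mul1r ?mulrNN ?mulr1 ?eqxx ?n1.
Qed.

Lemma swap_notin j : swap j \notin SSL.
Proof. by rewrite (mem_SSL (swap_SL j)) red_det_swap opp1_neq1. Qed.

Lemma SSL_index2 : #|SL : SSL|%g = 2%N.
Proof.
have [kSL kS] := (swap_SL ord0, swap_notin ord0); move: (swap ord0) kSL kS => k kSL kS.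
pose G := Group (SL_group hsA heps).
have sHG := SSL_sub_SL hsA heps : SSL \subset G.
have kV : (k^-1)%g \notin SSL by rewrite groupV.
have kVSL := SL_inv hsA heps kSL.
have dE : SL :\: SSL = (SSL :* k)%g.
  apply/setP=> g; rewrite mem_rcoset finset.in_setD.
  apply/idP/idP => [/andP[gS gSL]|gk].
    by rewrite (mem_SSL_mul gSL kVSL) (negPf gS) (negPf kV).
  have gkSL := fintype.subsetP sHG _ gk.
  have gE : g = (g * k^-1 * k)%g by rewrite mulgKV.
  have gSL : g \in SL by rewrite gE (SLM hsA heps gkSL kSL).
  by rewrite gSL andbT gE (mem_SSL_mul gkSL kSL) gk (negPf kS).
have := Lagrange sHG; have := cardsID SSL SL.
rewrite dE card_rcoset (finset.setIidPr sHG) => <- /eqP.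
by rewrite addnn -muln2 eqn_pmul2l ?cardG_gt0 // => /eqP.
Qed.

End Ramified.

End LocalRing.

(** * The Bruhat elements determine the Weil representation *)

Theorem theorem12p5 (R : realType) (eps : int) (heps : eps = 1 \/ eps = -1)
  (B : finUnitRingType) (h2 : (2%:R : B) \is a GRing.unit)
  (star : B -> B) (hstar : is_involution star)
  (beta : B -> R[i]) (hbeta : linear_character beta)
  (hprim : primitive_character beta)
  (hbeta_eps : forall b, beta (b + eps%:~R * star b) = 1)
  (m n : nat) (hm : eps = 1 -> m.+1 = (2 * n)%N)
  (I : {set colspace B m}) (hI : half_system I)
  (X : vectType R[i]) (e : colspace B m -> X)
  (he : basis_of fullv (codom e)) :
  let A : finUnitRingType := matring B m in
  let starA : A -> A := @star_trmx B star m in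
  let chi := weil_chi star beta in
  let gamma := weil_gamma star eps beta in
  let alpha := mu R I in
  let f := weil_f star eps m beta n in
  let SL := SLstar starA eps in
  let SSL := SSLstar starA eps in
  [/\ is_data starA eps chi gamma alpha f,
      unique_weil_on star eps beta e SSL alpha gamma chi f
    & local_ring B ->
      (~ (eps = 1 /\ ramified star) ->
         unique_weil_on star eps beta e SL alpha gamma chi f) /\
      (eps = 1 /\ ramified star ->
         ~ unique_weil_on star eps beta e SL alpha gamma chi f /\
         #|SL : SSL|%g = 2%N)].
Proof.
move=> A starA chi gamma alpha f SL SSL.
have onSSL := weil_on_SSL heps h2 hstar hbeta hprim hbeta_eps he hI hm.
split; [exact: (weil_is_data heps h2 hstar hbeta hprim hbeta_eps he hI hm) | exact: onSSL |].
move=> hloc; have [F [rho [rho_surj rho0]]] := local_residue_field hloc.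
have hsA := star_trmx_involution hstar m.
split=> [hn|[e1 hr]].
  have -> : SL = SSL; last exact: onSSL.
  have [he1|he1] := heps; last exact: (SSL_symplectic hloc hstar heps h2 m rho_surj rho0 he1).
  by apply: (SSL_unramified hloc hstar heps h2 m rho_surj rho0 he1) => hr; apply: hn.
have hmn := hm e1.
split; last exact: (SSL_index2 hloc hstar heps h2 rho_surj rho0 hmn e1 hr).
have kSL := swap_SL hstar e1 (ord0 : 'I_m.+1).
have kS := swap_notin hloc hstar heps h2 rho_surj rho0 hmn e1 hr ord0.
apply: (not_unique_weil he _ _ _ _ kSL kS (SL_inv hsA heps kSL)).
- by move=> g g'; exact: (SLM hsA heps).
- exact: (SL1 hsA heps).
- exact: (SSL_sub_SL hsA heps).
- exact: (mem_SSL_mul hloc hstar heps h2 rho_surj rho0 hmn e1 hr).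
Qed.
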